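(* Let $M$ be a finitely generated right module over a ring $R$, and let $S=\mathrm{End}_R(M)$. Let $X$ be an object of $\mathrm{Add}(M)$. Let $P_S=\mathrm{Hom}_R(M,X)$, and let $I=\mathrm{Tr}_S(P)$. Then: (i) $I=\mathcal{I}_X(M,M)=\mathcal{J}_X(M,M)$ and, for any $B\in\mathrm{Add}(M)$, $\mathcal{I}_X(M,B)=\mathcal{J}_X(M,B)=\mathrm{Hom}_R(M,B)I$. (ii) The functor $F=\mathrm{Hom}_R(M,-)\otimes_S S/I$ induces an equivalence between the categories $\mathrm{Add}(M)/\mathcal{J}_X$ and $\mathrm{Add}(S/I)$. (iii) If $X$ is an object of $\mathrm{Add}_{\aleph_0}(M)$, then the functor $F$ restricts to a category equivalence between $\mathrm{Add}_{\aleph_0}(M)/\mathcal{J}_X$ and the category of countably generated projective right modules over $S/I$.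
   Context: Rings are associative with $1$, not necessarily commutative. For a right $R$-module $M$, $\mathrm{Add}(M)$ is the full subcategory of right $R$-modules isomorphic to direct summands of arbitrary direct sums of copies of $M$. $\mathrm{Add}_{\aleph_0}(M)$ is the full subcategory of $\mathrm{Add}(M)$ whose objects are the countably generated modules in $\mathrm{Add}(M)$. $\mathrm{Add}(S/I)$ is the category of projective right $S/I$-modules. For a projective right $S$-module $P$, the trace ideal is $\mathrm{Tr}_S(P)=\sum_{f\in\mathrm{Hom}_S(P,S)}f(P)$, a two-sided ideal of $S$. For $X,A,B\in\mathrm{Add}(M)$, $\mathcal{I}_X(A,B)$ is the set of $f\in\mathrm{Hom}_R(A,B)$ that factor through $X^n$ for some $n\in\mathbb{N}$, and $\mathcal{J}_X(A,B)$ is the set of $f\in\mathrm{Hom}_R(A,B)$ that factor through $X^{(\Lambda)}$ (a direct sum of copies of $X$) for some set $\Lambda$. These are two-sided ideals of the additive category $\mathrm{Add}(M)$. For an ideal $\mathcal{J}$ of an additive category $\mathcal{C}$, the quotient category $\mathcal{C}/\mathcal{J}$ has the same objects as $\mathcal{C}$ and morphism groups $\mathrm{Hom}_{\mathcal{C}}(A,B)/\mathcal{J}(A,B)$. $\mathrm{Hom}_R(M,B)$ is a right $S$-module by composition. *)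

(* Defs.v *)
From HB Require Import structures.
From mathcomp Require Import all_boot all_order all_algebra.
From mathcomp Require Import all_classical.
From mathcomp Require Import freeg.

Set Implicit Arguments.
Unset Strict Implicit.
Unset Printing Implicit Defensive.

Import GRing.Theory.
Local Open Scope ring_scope.
Local Open Scope quotient_scope.

(* A right R-module is a left module over the converse ring [R^c]:
   [r *: x] stands for the right action [x r]. *)
Notation rmodType R := (lmodType R^c).

(* The right regular module: [r *: x] is [x * r] in [R]. *)
Notation rregular R := (R^c)^o.

Section HomZmod.
Variables (R : pzRingType) (U V : lmodType R).
Implicit Types f g h : {linear U -> V}.

Lemma linear_eq f g : f =1 g -> f = g.
Proof.
case: f g => [f [[f1] [f2]]] [g [[g1] [g2]]] /= /funext fg; subst g.
by rewrite (Prop_irrelevance f1 g1) (Prop_irrelevance f2 g2).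
Qed.

HB.instance Definition _ := gen_eqMixin {linear U -> V}.
HB.instance Definition _ := gen_choiceMixin {linear U -> V}.

Definition lin_zero : {linear U -> V} := \0.
Definition lin_opp f : {linear U -> V} := \- f.
Definition lin_add f g : {linear U -> V} := f \+ g.

Fact lin_addA : associative lin_add.
Proof. by move=> f g h; apply: linear_eq => x /=; rewrite addrA. Qed.
Fact lin_addC : commutative lin_add.
Proof. by move=> f g; apply: linear_eq => x /=; rewrite addrC. Qed.
Fact lin_add0 : left_id lin_zero lin_add.
Proof. by move=> f; apply: linear_eq => x /=; rewrite add0r. Qed.
Fact lin_addN : left_inverse lin_zero lin_opp lin_add.
Proof. by move=> f; apply: linear_eq => x /=; rewrite addNr. Qed.

HB.instance Definition _ :=
  GRing.isZmodule.Build {linear U -> V} lin_addA lin_addC lin_add0 lin_addN.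

Lemma lin_addE f g x : (f + g) x = f x + g x. Proof. by []. Qed.
Lemma lin_oppE f x : (- f) x = - f x. Proof. by []. Qed.
Lemma lin_subE f g x : (f - g) x = f x - g x. Proof. by []. Qed.
Lemma lin_zeroE x : (0 : {linear U -> V}) x = 0. Proof. by []. Qed.
Lemma lin_sumE I (r : seq I) (P : pred I) (F : I -> {linear U -> V}) x :
  (\sum_(i <- r | P i) F i) x = \sum_(i <- r | P i) F i x.
Proof. by elim/big_rec2: _ => // i y f _ <-. Qed.

End HomZmod.

Definition lin_comp (R : pzRingType) (U V W : lmodType R)
  (g : {linear V -> W}) (f : {linear U -> V}) : {linear U -> W} := g \o f.
Definition lin_id (R : pzRingType) (U : lmodType R) : {linear U -> U} := idfun.

Section EndRing.
Variables (R : pzRingType) (M : lmodType R).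

Definition endring := {linear M -> M}.
HB.instance Definition _ := GRing.Zmodule.on endring.

Fact end_mulA : associative (@lin_comp R M M M : endring -> endring -> endring).
Proof. by move=> f g h; apply: linear_eq. Qed.
Fact end_mul1l : left_id (lin_id M : endring) (@lin_comp R M M M).
Proof. by move=> f; apply: linear_eq. Qed.
Fact end_mul1r : right_id (lin_id M : endring) (@lin_comp R M M M).
Proof. by move=> f; apply: linear_eq. Qed.
Fact end_mulDl : left_distributive (@lin_comp R M M M : endring -> endring -> endring) +%R.
Proof. by move=> f g h; apply: linear_eq. Qed.
Fact end_mulDr : right_distributive (@lin_comp R M M M : endring -> endring -> endring) +%R.
Proof. by move=> f g h; apply: linear_eq => x /=; rewrite linearD. Qed.

HB.instance Definition _ := GRing.Zmodule_isPzRing.Build endring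
  end_mulA end_mul1l end_mul1r end_mulDl end_mulDr.
End EndRing.

Section HomModule.
Variables (R : pzRingType) (M : lmodType R).

(* [Hom_R(M, B)] is a right [End_R(M)]-module by precomposition: [f s = f \o s]. *)
Definition hom_scale (B : lmodType R) (s : (endring M)^c) (f : {linear M -> B})
  : {linear M -> B} := lin_comp f (s : endring M).

Section Laws.
Variable B : lmodType R.
Fact hom_scaleA (s t : (endring M)^c) (f : {linear M -> B}) :
  hom_scale s (hom_scale t f) = hom_scale (s * t) f.
Proof. by apply: linear_eq. Qed.
Fact hom_scale1 : left_id 1 (@hom_scale B).
Proof. by move=> f; apply: linear_eq. Qed.
Fact hom_scaleDr : right_distributive (@hom_scale B) +%R.
Proof. by move=> s f g; apply: linear_eq. Qed.
Fact hom_scaleDl (f : {linear M -> B}) : {morph (@hom_scale B)^~ f : s t / s + t}.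
Proof. by move=> s t; apply: linear_eq => x /=; rewrite linearD. Qed.

HB.instance Definition _ := GRing.Zmodule_isLmodule.Build (endring M)^c
  {linear M -> B} hom_scaleA hom_scale1 hom_scaleDr hom_scaleDl.
End Laws.

Section Post.
Variables (A B : lmodType R) (g : {linear A -> B}).
Definition hom_post_fun (f : {linear M -> A}) : {linear M -> B} := lin_comp g f.
Fact hom_post_is_linear :
  linear (hom_post_fun : {linear M -> A} -> {linear M -> B}).
Proof.
by move=> s f f'; apply: linear_eq => x; rewrite /= linearD.
Qed.
HB.instance Definition _ := GRing.isLinear.Build (endring M)^c {linear M -> A}
  {linear M -> B} *:%R hom_post_fun hom_post_is_linear.
Definition hom_post : {linear {linear M -> A} -> {linear M -> B}} := hom_post_fun.
End Post.
End HomModule.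

Section DirectSum.
Variables (R : pzRingType) (I : Type) (N : lmodType R).

Definition fin_supp : {pred I -> N} :=
  fun f => `[< finite_set [set i | f i != 0] >].

Fact fin_supp_closed : submod_closed fin_supp.
Proof.
split=> [|a f g /asboolP ff /asboolP fg]; apply/asboolP.
  by rewrite (_ : mkset _ = set0) //; apply/seteqP; split=> i //=; rewrite eqxx.
apply: (@sub_finite_set _ _ ([set i | f i != 0] `|` [set i | g i != 0])%classic);
  last by rewrite finite_setU.
move=> i; have [fi0|] := eqVneq (f i) 0; last by left.
by move=> /eqP fgi; right; apply/eqP => gi0; apply: fgi;
  rewrite addrfctE scalrfctE /= fi0 gi0 scaler0 addr0.
Qed.
HB.instance Definition _ :=
  GRing.isSubmodClosed.Build R (I -> N) fin_supp fin_supp_closed.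

(* The direct sum of copies of [N] indexed by [I]. *)
Record dsum := DSum { dsum_val :> I -> N; _ : dsum_val \in fin_supp }.
HB.instance Definition _ := [isSub for dsum_val].
HB.instance Definition _ := gen_eqMixin dsum.
HB.instance Definition _ := gen_choiceMixin dsum.
HB.instance Definition _ := [SubChoice_isSubLmodule of dsum by <:].

Lemma dsumE (x y : dsum) : (forall i, x i = y i) -> x = y.
Proof. by move=> xy; apply/val_inj/funext. Qed.

End DirectSum.

Section Modules.
Variable R : pzRingType.
Implicit Types A B C M N U X : lmodType R.

Definition isomorphic A B := exists f : {linear A -> B}, bijective f.

(* [B] is isomorphic to a direct summand of [N]. *)
Definition iso_summand B N := exists C, isomorphic (B * C)%type N.

Definition fin_generated M :=
  exists (n : nat) (e : 'I_n -> M),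
    forall x, exists c : 'I_n -> R, x = \sum_(i < n) c i *: e i.

Definition count_generated M :=
  exists e : nat -> M,
    forall x, exists (n : nat) (c : nat -> R), x = \sum_(i < n) c i *: e i.

Definition in_Add M B := exists I : Type, iso_summand B (dsum I M).

Definition in_Add0 M B := in_Add M B /\ count_generated B.

(* [factI X A B] and [factJ X A B] are the sets of maps factoring through [X^n]
   for some [n], resp. through [X^(I)] for some set [I]. *)
Definition factors_through U A B : set {linear A -> B} :=
  [set f : {linear A -> B} | exists (g : {linear A -> U}) (h : {linear U -> B}), f =1 h \o g].

Definition factI X A B : set {linear A -> B} :=
  [set f : {linear A -> B} | exists n : nat, factors_through {ffun 'I_n -> X} f].

Definition factJ X A B : set {linear A -> B} :=
  [set f : {linear A -> B} | exists I : Type, factors_through (dsum I X) f].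
End Modules.

Arguments factI {R} X A B.
Arguments factJ {R} X A B.

(* Finite sums of elements of [G]: the subgroup generated by [G] whenever [G] is
   stable under opposite, as in all the uses below. *)
Definition fsums (V : zmodType) (G : set V) : set V :=
  [set x | exists2 s : seq V, (forall y, y \in s -> G y) & x = \sum_(y <- s) y].

Lemma fsums_zmod_closed (V : zmodType) (G : set V) :
  (forall x, G x -> G (- x)) -> zmod_closed (fun x => `[< fsums G x >]).
Proof.
move=> GN; split=> [|x y /asboolP[s sG ->] /asboolP[t tG ->]]; apply/asboolP.
  by exists [::] => //; rewrite big_nil.
exists (s ++ [seq - z | z <- t]).
  move=> z; rewrite mem_cat => /orP[/sG //|/mapP[w wt ->]].
  exact/GN/tG.
by rewrite big_cat big_map /= sumrN.
Qed.

(* Two-sided ideals, not necessarily proper. *)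
Record bideal (S : pzRingType) := BIdeal {
  bideal_pred :> zmodClosed S;
  bidealMl : forall a x, x \in bideal_pred -> a * x \in bideal_pred;
  bidealMr : forall a x, x \in bideal_pred -> x * a \in bideal_pred }.

Section Trace.
Variables (S : pzRingType) (P : rmodType S).

Definition trace : set S :=
  fsums [set s : S | exists (f : {linear P -> rregular S}) (p : P), s = f p].

Definition trace_pred : {pred S} := fun s => `[< trace s >].

Fact trace_zmod_closed : zmod_closed trace_pred.
Proof.
apply: fsums_zmod_closed => _ [f [p ->]].
by exists f, (- p); rewrite raddfN.
Qed.
HB.instance Definition _ := GRing.isZmodClosed.Build S trace_pred trace_zmod_closed.

Definition lmul_fun (a : S) (x : rregular S) : rregular S := a * (x : S).
Fact lmul_is_linear (a : S) : linear (lmul_fun a).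
Proof. by move=> s x y; rewrite /lmul_fun mulrDr; congr (_ + _); exact: (@mulrA S a x s). Qed.
HB.instance Definition _ (a : S) := GRing.isLinear.Build S^c (rregular S)
  (rregular S) *:%R (lmul_fun a) (lmul_is_linear a).

Fact traceMl (a x : S) : x \in trace_pred -> a * x \in trace_pred.
Proof.
move=> /asboolP[s sG ->]; apply/asboolP; exists [seq a * z | z <- s].
  move=> _ /mapP[z /sG[f [p ->]] ->].
  by exists (lin_comp (lmul_fun a) f), p.
by rewrite big_map mulr_sumr.
Qed.

Fact traceMr (a x : S) : x \in trace_pred -> x * a \in trace_pred.
Proof.
move=> /asboolP[s sG ->]; apply/asboolP; exists [seq z * a | z <- s].
  by move=> _ /mapP[z /sG[f [p ->]] ->]; exists f, ((a : S^c) *: p); rewrite linearZ.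
by rewrite big_map mulr_suml.
Qed.

Definition trace_ideal : bideal S := BIdeal traceMl traceMr.
End Trace.

(* [N I] for a right module [N] and an ideal [I]. *)
Definition mod_ideal (S : pzRingType) (N : rmodType S) (I : set S) : set N :=
  fsums [set x : N | exists (v : N) (a : S), I a /\ x = (a : S^c) *: v].

Section QuotientGroup.
Variables (V : zmodType) (I : zmodClosed V).

Definition qpi (x : V) : Quotient.quot I := \pi_(Quotient.quot I) x.

Lemma qpi_eq x y : qpi x = qpi y <-> x - y \in I.
Proof. by rewrite Quotient.idealrBE; split=> [e|/eqP //]; apply/eqP. Qed.

Lemma qpi_eq0 x : qpi x = 0 <-> x \in I.
Proof.
have -> : (0 : Quotient.quot I) = qpi 0.
  by rewrite /qpi (raddf0 (\pi_(Quotient.quot I))).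
by rewrite qpi_eq subr0.
Qed.

Lemma qpiK (x : Quotient.quot I) : qpi (repr x) = x. Proof. exact: reprK. Qed.

Lemma repr_qpi x : repr (qpi x) - x \in I. Proof. by apply/qpi_eq; rewrite qpiK. Qed.

Fact qpi_is_zmod_morphism : zmod_morphism qpi.
Proof. exact: pi_is_zmod_morphism. Qed.
HB.instance Definition _ :=
  GRing.isZmodMorphism.Build V (Quotient.quot I) qpi qpi_is_zmod_morphism.
End QuotientGroup.

Section QuotientRing.
Variables (S : pzRingType) (I : bideal S).

Definition qring := Quotient.quot I.
HB.instance Definition _ := GRing.Zmodule.on qring.

Definition qproj (x : S) : qring := qpi I x.
Fact qproj_is_zmod_morphism : zmod_morphism qproj.
Proof. exact: qpi_is_zmod_morphism. Qed.
HB.instance Definition _ :=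
  GRing.isZmodMorphism.Build S qring qproj qproj_is_zmod_morphism.
Definition qring_repr (x : qring) : S := repr (x : Quotient.quot I).
Lemma qprojK x : qproj (qring_repr x) = x. Proof. exact: qpiK. Qed.

Definition qring_one : qring := qproj 1.
Definition qring_mul (x y : qring) : qring := qproj (qring_repr x * qring_repr y).

Lemma qprojM x y : qproj (x * y) = qring_mul (qproj x) (qproj y).
Proof.
apply/esym/qpi_eq; rewrite -/(qring_repr _) -/(qproj _).
set x' := qring_repr _; set y' := qring_repr _.
rewrite (_ : _ - _ = (x' - x) * y' + x * (y' - y)).
  by apply: rpredD; [apply: bidealMr | apply: bidealMl]; apply: repr_qpi.
by rewrite mulrBl mulrBr addrA subrK.
Qed.

Fact qring_mulA : associative qring_mul.
Proof.
move=> x y z; rewrite -[x]qprojK -[y]qprojK -[z]qprojK.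
by rewrite -!qprojM mulrA.
Qed.
Fact qring_mul1l : left_id qring_one qring_mul.
Proof. by move=> x; rewrite -[x]qprojK -qprojM mul1r. Qed.
Fact qring_mul1r : right_id qring_one qring_mul.
Proof. by move=> x; rewrite -[x]qprojK -qprojM mulr1. Qed.
Fact qring_mulDl : left_distributive qring_mul +%R.
Proof.
move=> x y z; rewrite -[x]qprojK -[y]qprojK -[z]qprojK.
by rewrite -raddfD -!qprojM mulrDl raddfD.
Qed.
Fact qring_mulDr : right_distributive qring_mul +%R.
Proof.
move=> x y z; rewrite -[x]qprojK -[y]qprojK -[z]qprojK.
by rewrite -raddfD -!qprojM mulrDr raddfD.
Qed.
HB.instance Definition _ := GRing.Zmodule_isPzRing.Build qring
  qring_mulA qring_mul1l qring_mul1r qring_mulDl qring_mulDr.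

Fact qproj_is_monoid_morphism : monoid_morphism qproj.
Proof. by split=> // x y; rewrite qprojM. Qed.
HB.instance Definition _ :=
  GRing.isMonoidMorphism.Build S qring qproj qproj_is_monoid_morphism.

(* [S/I] as a left [S]-module. *)
Definition qring_scale (s : S) (x : qring) : qring := qproj s * x.
Fact qring_scaleA s t x : qring_scale s (qring_scale t x) = qring_scale (s * t) x.
Proof. by rewrite /qring_scale rmorphM mulrA. Qed.
Fact qring_scale1 : left_id 1 qring_scale.
Proof. by move=> x; rewrite /qring_scale rmorph1 mul1r. Qed.
Fact qring_scaleDr : right_distributive qring_scale +%R.
Proof. by move=> s x y; rewrite /qring_scale mulrDr. Qed.
Fact qring_scaleDl x : {morph qring_scale^~ x : s t / s + t}.
Proof. by move=> s t; rewrite /qring_scale rmorphD mulrDl. Qed.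
HB.instance Definition _ := GRing.Zmodule_isLmodule.Build S qring
  qring_scaleA qring_scale1 qring_scaleDr qring_scaleDl.
End QuotientRing.

(* The tensor product over a possibly noncommutative ring, as an abelian group:
   the free abelian group on [A * B] modulo the usual relations. *)
Section Tensor.
Variables (S : pzRingType) (A : rmodType S) (B : lmodType S).

Local Notation free := {freeg (A * B)%type / int}.
Definition fgen (a : A) (b : B) : free := << (a, b) >>.

Inductive tens_rel : free -> Prop :=
| tens_rel0 : tens_rel 0
| tens_relB x y : tens_rel x -> tens_rel y -> tens_rel (x - y)
| tens_relDl a a' b : tens_rel (fgen (a + a') b - fgen a b - fgen a' b)
| tens_relDr a b b' : tens_rel (fgen a (b + b') - fgen a b - fgen a b')
| tens_relM a (s : S) b : tens_rel (fgen ((s : S^c) *: a) b - fgen a (s *: b)).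

Definition tens_pred : {pred free} := fun x => `[< tens_rel x >].
Fact tens_zmod_closed : zmod_closed tens_pred.
Proof.
split; first exact/asboolP/tens_rel0.
by move=> x y /asboolP ? /asboolP ?; apply/asboolP/tens_relB.
Qed.
HB.instance Definition _ := GRing.isZmodClosed.Build free tens_pred tens_zmod_closed.

Definition tens := Quotient.quot tens_pred.
HB.instance Definition _ := GRing.Zmodule.on tens.

Definition pure (a : A) (b : B) : tens := qpi tens_pred (fgen a b).

Lemma pureDl a a' b : pure (a + a') b = pure a b + pure a' b.
Proof.
apply/eqP; rewrite -subr_eq0 opprD addrA /pure -!raddfB; apply/eqP/qpi_eq0.
by apply/asboolP/tens_relDl.
Qed.
Lemma pureDr a b b' : pure a (b + b') = pure a b + pure a b'.
Proof.
apply/eqP; rewrite -subr_eq0 opprD addrA /pure -!raddfB; apply/eqP/qpi_eq0.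
by apply/asboolP/tens_relDr.
Qed.
Lemma pure_balanced a (s : S) b : pure ((s : S^c) *: a) b = pure a (s *: b).
Proof. by apply/qpi_eq/asboolP/tens_relM. Qed.

Definition balanced (V : zmodType) (f : A -> B -> V) :=
  [/\ forall a a' b, f (a + a') b = f a b + f a' b,
      forall a b b', f a (b + b') = f a b + f a b'
    & forall a (s : S) b, f ((s : S^c) *: a) b = f a (s *: b)].

Section Lift.
Variables (V : zmodType) (f : A -> B -> V).

Definition free_lift (x : free) : V :=
  fglift (fun ab : A * B => (f ab.1 ab.2 : zmodule V)) x.

Fact free_lift_is_zmod_morphism : zmod_morphism free_lift.
Proof. by move=> x y; apply: (@lift_is_additive _ _ (zmodule V)). Qed.
HB.instance Definition _ :=
  GRing.isZmodMorphism.Build free V free_lift free_lift_is_zmod_morphism.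

Lemma free_lift_gen a b : free_lift (fgen a b) = f a b.
Proof. by rewrite /free_lift /fgen liftU scale1r. Qed.

(* The additive map [pure a b |-> f a b], meaningful when [f] is balanced. *)
Definition tens_lift (x : tens) : V := free_lift (repr (x : Quotient.quot tens_pred)).

Hypothesis f_bal : balanced f.

Lemma tens_lift_pi x : tens_lift (qpi tens_pred x) = free_lift x.
Proof.
case: f_bal => fDl fDr fM; apply/eqP; rewrite -subr_eq0 -raddfB; apply/eqP.
have: tens_rel (repr (qpi tens_pred x) - x) by apply/asboolP; apply: (repr_qpi tens_pred x).
elim=> [|y z _ y0 _ z0|a a' b|a b b'|a s b]; first exact: raddf0.
- by rewrite raddfB y0 z0 subr0.
- by rewrite 2!raddfB /= !free_lift_gen fDl -addrA -opprD subrr.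
- by rewrite 2!raddfB /= !free_lift_gen fDr -addrA -opprD subrr.
- by rewrite raddfB /= !free_lift_gen fM subrr.
Qed.

Lemma tens_lift_pure a b : tens_lift (pure a b) = f a b.
Proof. by rewrite tens_lift_pi free_lift_gen. Qed.

Lemma tens_lift_is_zmod_morphism : zmod_morphism tens_lift.
Proof.
move=> x y; rewrite -[x in LHS]qpiK -[y in LHS]qpiK -raddfB tens_lift_pi.
by rewrite raddfB.
Qed.
End Lift.

Lemma tens_ind (Q : tens -> Prop) :
  Q 0 -> (forall x y, Q x -> Q y -> Q (x - y)) -> (forall a b, Q (pure a b)) ->
  forall x, Q x.
Proof.
move=> Q0 QB Qp x; rewrite -[x]qpiK; set y : free := repr _.
have QN z : Q z -> Q (- z) by rewrite -[- z]sub0r; apply: QB.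
have QD z t : Q z -> Q t -> Q (z + t) by move=> ? /QN ?; rewrite -[t]opprK; apply: QB.
rewrite -(freeg_sumE y) raddf_sum; elim/big_ind: _ => // -[a b] _.
have QM n : Q (pure a b *+ n) by elim: n => // n IH; rewrite mulrS; apply: QD.
have -> (k : int) : << k *g (a, b) >> = fgen a b *~ k by rewrite /fgen freegU_mulz intz.
rewrite raddfMz; case: (coeff _ _) => n; first exact: QM.
by rewrite NegzE mulrNz; apply/QN/QM.
Qed.

Lemma tens_ext (V : zmodType) (f g : tens -> V) :
  zmod_morphism f -> zmod_morphism g ->
  (forall a b, f (pure a b) = g (pure a b)) -> f =1 g.
Proof.
move=> fB gB fg; apply: tens_ind => // [|x y xE yE]; last by rewrite fB gB xE yE.
by rewrite -(subrr (0 : tens)) fB gB !subrr.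
Qed.
End Tensor.

Section TensorQuotient.
Variables (S : pzRingType) (I : bideal S).

(* [A (x)_S S/I], with the right [S/I]-action [(a (x) b) t = a (x) b t]. *)
Definition tens_quo (A : rmodType S) := tens A (qring I).

Section Action.
Variable A : rmodType S.
HB.instance Definition _ := GRing.Zmodule.on (tens_quo A).

Implicit Types (a : A) (b t : qring I).

Definition tens_act (t : (qring I)^c) (x : tens_quo A) : tens_quo A :=
  tens_lift (fun a b => pure a (b * (t : qring I))) x.

Fact tens_act_balanced t : balanced (fun a b => pure a (b * t)).
Proof.
split=> [a a' b|a b b'|a s b]; first by rewrite pureDl.
  by rewrite mulrDl pureDr.
by rewrite pure_balanced; congr pure; apply: mulrA.
Qed.

Lemma tens_act_pure t a b : tens_act t (pure a b) = pure a (b * t).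
Proof. exact/tens_lift_pure/tens_act_balanced. Qed.

Fact tens_act_is_zmod_morphism t : zmod_morphism (tens_act t).
Proof. exact/tens_lift_is_zmod_morphism/tens_act_balanced. Qed.

Fact tens_actA t u (x : tens_quo A) :
  tens_act t (tens_act u x) = tens_act ((t : (qring I)^c) * u) x.
Proof.
apply: (tens_ext (f := fun x => tens_act t (tens_act u x))) => [y z|y z|a b].
- by rewrite !tens_act_is_zmod_morphism.
- by rewrite !tens_act_is_zmod_morphism.
- by rewrite !tens_act_pure; congr pure; apply/esym/mulrA.
Qed.
Fact tens_act1 : left_id (1 : (qring I)^c) tens_act.
Proof.
apply: (tens_ext (f := tens_act 1) (g := id)) => [y z|y z|a b] //.
  by rewrite !tens_act_is_zmod_morphism.
by rewrite tens_act_pure mulr1.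
Qed.
Fact tens_actDr : right_distributive tens_act +%R.
Proof.
move=> t x y; rewrite -{1}[y]opprK tens_act_is_zmod_morphism.
by rewrite -[- y]sub0r tens_act_is_zmod_morphism -(subrr 0)
  tens_act_is_zmod_morphism subrr sub0r opprK.
Qed.
Fact tens_actDl x :
  {morph tens_act^~ x : t u / (t : (qring I)^c) + u >-> t + u}.
Proof.
move=> t u; apply: (tens_ext (f := fun x => tens_act (t + u) x)
  (g := fun x => tens_act t x + tens_act u x)) => [y z|y z|a b].
- by rewrite !tens_act_is_zmod_morphism.
- by rewrite !tens_act_is_zmod_morphism opprD addrACA.
- by rewrite !tens_act_pure -pureDr; congr pure; apply: (@mulrDr (qring I)).
Qed.
HB.instance Definition _ := GRing.Zmodule_isLmodule.Build (qring I)^c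
  (tens_quo A) tens_actA tens_act1 tens_actDr tens_actDl.
End Action.

Section Map.
Variables (A A' : rmodType S) (g : {linear A -> A'}).

Definition tens_map_fun (x : tens_quo A) : tens_quo A' :=
  tens_lift (fun a b => pure (g a) b) x.

Fact tens_map_balanced :
  balanced (fun (a : A) (b : qring I) => pure (g a) b).
Proof.
split=> [a a' b|a b b'|a s b]; first by rewrite raddfD pureDl.
  by rewrite pureDr.
by rewrite linearZ pure_balanced.
Qed.

Lemma tens_map_pure a b : tens_map_fun (pure a b) = pure (g a) b.
Proof. exact/tens_lift_pure/tens_map_balanced. Qed.

Fact tens_map_is_zmod_morphism : zmod_morphism tens_map_fun.
Proof. exact/tens_lift_is_zmod_morphism/tens_map_balanced. Qed.
HB.instance Definition _ := GRing.isZmodMorphism.Build (tens_quo A) (tens_quo A')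
  tens_map_fun tens_map_is_zmod_morphism.

Fact tens_map_scalable (t : (qring I)^c) (x : tens_quo A) :
  tens_map_fun (t *: x) = t *: tens_map_fun x.
Proof.
apply: (tens_ext (f := fun x => tens_map_fun (tens_act t x))
  (g := fun x => tens_act t (tens_map_fun x))) => [y z|y z|a b].
- by rewrite tens_act_is_zmod_morphism raddfB.
- by rewrite raddfB tens_act_is_zmod_morphism.
- by rewrite !(tens_act_pure, tens_map_pure).
Qed.
HB.instance Definition _ := GRing.isScalable.Build (qring I)^c (tens_quo A)
  (tens_quo A') *:%R tens_map_fun tens_map_scalable.

Definition tens_map : {linear tens_quo A -> tens_quo A'} := tens_map_fun.
End Map.
End TensorQuotient.

(* Preadditive categories and additive functors. *)
Record precat := Precat {
  ob :> Type;
  hom : ob -> ob -> zmodType;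
  idc : forall A, hom A A;
  ccomp : forall A B C, hom B C -> hom A B -> hom A C;
  comp1l : forall A B (f : hom A B), ccomp (idc B) f = f;
  comp1r : forall A B (f : hom A B), ccomp f (idc A) = f;
  compA : forall A B C D (h : hom C D) (g : hom B C) (f : hom A B),
    ccomp h (ccomp g f) = ccomp (ccomp h g) f;
  compBl : forall A B C (g g' : hom B C) (f : hom A B),
    ccomp (g - g') f = ccomp g f - ccomp g' f;
  compBr : forall A B C (g : hom B C) (f f' : hom A B),
    ccomp g (f - f') = ccomp g f - ccomp g f' }.

Arguments idc {p} A.
Arguments ccomp {p A B C} g f.
Infix "\oc" := ccomp (at level 40, left associativity).

Record functor (C D : precat) := Functor {
  fob :> C -> D;
  fmap : forall A B, hom A B -> hom (fob A) (fob B);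
  fmapB : forall A B, zmod_morphism (@fmap A B);
  fmap1 : forall A, fmap (idc A) = idc (fob A);
  fmapM : forall A B C (g : hom B C) (f : hom A B),
    fmap (g \oc f) = fmap g \oc fmap f }.

Definition functor_id (C : precat) : functor C C :=
  @Functor C C id (fun A B f => f) (fun A B f g => erefl) (fun A => erefl)
    (fun A B C g f => erefl).

Section FunctorComp.
Variables (C D E : precat) (G : functor D E) (F : functor C D).
Definition fcomp_map (A B : C) (f : hom A B) : hom (G (F A)) (G (F B)) :=
  fmap G (fmap F f).
Fact fcomp_mapB A B : zmod_morphism (@fcomp_map A B).
Proof. by move=> f g; rewrite /fcomp_map !fmapB. Qed.
Fact fcomp_map1 A : fcomp_map (idc A) = idc (G (F A)).
Proof. by rewrite /fcomp_map !fmap1. Qed.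
Fact fcomp_mapM (X Y Z : C) (g : hom Y Z) (f : hom X Y) :
  fcomp_map (g \oc f) = fcomp_map g \oc fcomp_map f.
Proof. by rewrite /fcomp_map !fmapM. Qed.
Definition functor_comp : functor C E := Functor fcomp_mapB fcomp_map1 fcomp_mapM.
End FunctorComp.

Definition nat_iso (C D : precat) (F G : functor C D) :=
  exists (u : forall A, hom (F A) (G A)) (v : forall A, hom (G A) (F A)),
  [/\ forall A, v A \oc u A = idc (F A),
      forall A, u A \oc v A = idc (G A)
    & forall A B (f : hom A B), u B \oc fmap F f = fmap G f \oc u A].

Definition is_equivalence (C D : precat) (F : functor C D) :=
  exists G : functor D C,
    nat_iso (functor_comp G F) (functor_id C) /\
    nat_iso (functor_comp F G) (functor_id D).

Section FullSubcategory.
Variables (C : precat) (P : C -> Prop).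
Definition full_sub : precat :=
  @Precat {A : C | P A} (fun A B => hom (sval A) (sval B))
    (fun A => idc (sval A)) (fun A B D g f => g \oc f)
    (fun A B f => comp1l f) (fun A B f => comp1r f)
    (fun A B D E h g f => compA h g f)
    (fun A B D g g' f => compBl g g' f) (fun A B D g f f' => compBr g f f').
End FullSubcategory.

Definition full_restrict (C D : precat) (F : functor C D)
    (P : C -> Prop) (Q : D -> Prop) (PQ : forall A, P A -> Q (F A)) :
  functor (full_sub P) (full_sub Q) :=
  @Functor (full_sub P) (full_sub Q) (fun A => exist Q (F (sval A)) (PQ _ (svalP A)))
    (fun A B f => fmap F f) (fun A B => @fmapB _ _ F _ _)
    (fun A => fmap1 F (sval A)) (fun A B E g f => fmapM F g f).

Arguments full_restrict {C D} F P Q PQ.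

(* Two-sided ideals of a preadditive category. *)
Record catideal (C : precat) := CatIdeal {
  cideal :> forall A B : C, zmodClosed (hom A B);
  cidealMl : forall (A B D : C) (g : hom B D) (f : hom A B),
    f \in cideal A B -> g \oc f \in cideal A D;
  cidealMr : forall (A B D : C) (g : hom B D) (f : hom A B),
    g \in cideal B D -> g \oc f \in cideal A D }.

Definition ideal_restrict (C : precat) (J : catideal C) (P : C -> Prop) :
  catideal (full_sub P) :=
  @CatIdeal (full_sub P) (fun A B => J (sval A) (sval B))
    (fun A B D g f => @cidealMl C J _ _ _ g f)
    (fun A B D g f => @cidealMr C J _ _ _ g f).

Section QuotientCategory.
Variables (C : precat) (J : catideal C).

Definition qhom (A B : C) : zmodType := Quotient.quot (J A B).
Definition qmor (A B : C) (f : hom A B) : qhom A B := qpi (J A B) f.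
Definition qlift (A B : C) (f : qhom A B) : hom A B :=
  repr (f : Quotient.quot (J A B)).
Lemma qliftK A B (f : qhom A B) : qmor (qlift f) = f. Proof. exact: qpiK. Qed.
Lemma qmor_eq A B (f g : hom A B) : qmor f = qmor g <-> f - g \in J A B.
Proof. exact: qpi_eq. Qed.
Lemma qmorB A B : zmod_morphism (@qmor A B).
Proof. exact: qpi_is_zmod_morphism. Qed.
Lemma qlift_mor A B (f : hom A B) : qlift (qmor f) - f \in J A B.
Proof. by apply/qmor_eq; rewrite qliftK. Qed.

Definition qcomp (A B D : C) (g : qhom B D) (f : qhom A B) : qhom A D :=
  qmor (qlift g \oc qlift f).
Lemma qmorM A B D (g : hom B D) (f : hom A B) : qmor (g \oc f) = qcomp (qmor g) (qmor f).
Proof.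
apply/esym/qmor_eq; set g' := qlift _; set f' := qlift _.
rewrite (_ : _ - _ = (g' - g) \oc f' + g \oc (f' - f)).
  by apply: rpredD; [apply: cidealMr | apply: cidealMl]; apply: qlift_mor.
by rewrite compBl compBr addrA subrK.
Qed.

Fact qcomp1l (A B : C) (f : qhom A B) : qcomp (qmor (idc B)) f = f.
Proof. by rewrite -[f]qliftK -qmorM comp1l. Qed.
Fact qcomp1r (A B : C) (f : qhom A B) : qcomp f (qmor (idc A)) = f.
Proof. by rewrite -[f]qliftK -qmorM comp1r. Qed.
Fact qcompA (A B D E : C) (h : qhom D E) (g : qhom B D) (f : qhom A B) :
  qcomp h (qcomp g f) = qcomp (qcomp h g) f.
Proof.
by rewrite -[f]qliftK -[g]qliftK -[h]qliftK -!qmorM compA.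
Qed.
Fact qcompBl (A B D : C) (g g' : qhom B D) (f : qhom A B) :
  qcomp (g - g') f = qcomp g f - qcomp g' f.
Proof. by rewrite -[f]qliftK -[g]qliftK -[g']qliftK -qmorB -!qmorM compBl qmorB. Qed.
Fact qcompBr (A B D : C) (g : qhom B D) (f f' : qhom A B) :
  qcomp g (f - f') = qcomp g f - qcomp g f'.
Proof. by rewrite -[f]qliftK -[g]qliftK -[f']qliftK -qmorB -!qmorM compBr qmorB. Qed.

Definition quot_cat : precat :=
  Precat qcomp1l qcomp1r qcompA qcompBl qcompBr.

Definition kills (D : precat) (F : functor C D) :=
  forall (A B : C) (f : hom A B), f \in J A B -> fmap F f = 0.

Section Induced.
Variables (D : precat) (F : functor C D) (FJ : kills F).
Definition ind_map (A B : C) (f : qhom A B) : hom (F A) (F B) := fmap F (qlift f).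
Lemma ind_map_mor A B (f : hom A B) : ind_map (qmor f) = fmap F f.
Proof.
by apply/eqP; rewrite -subr_eq0 /ind_map -fmapB; apply/eqP/FJ/qlift_mor.
Qed.
Fact ind_mapB A B : zmod_morphism (@ind_map A B).
Proof.
by move=> f g; rewrite -[f]qliftK -[g]qliftK -qmorB !ind_map_mor fmapB.
Qed.
Fact ind_map1 (A : C) : ind_map (@idc quot_cat A) = idc (F A).
Proof. by rewrite ind_map_mor fmap1. Qed.
Fact ind_mapM (X Y Z : C) (g : qhom Y Z) (f : qhom X Y) :
  ind_map (qcomp g f) = ind_map g \oc ind_map f.
Proof.
by rewrite -[f]qliftK -[g]qliftK -qmorM !ind_map_mor fmapM.
Qed.
(* The functor on the quotient category induced by a functor killing [J]. *)
Definition induced : functor quot_cat D :=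
  @Functor quot_cat D (fun A => F A) ind_map ind_mapB ind_map1 ind_mapM.
End Induced.
End QuotientCategory.

Section ModuleCategory.
Variable R : pzRingType.

Fact lin_comp1l (A B : lmodType R) (f : {linear A -> B}) : lin_comp (lin_id B) f = f.
Proof. exact: linear_eq. Qed.
Fact lin_comp1r (A B : lmodType R) (f : {linear A -> B}) : lin_comp f (lin_id A) = f.
Proof. exact: linear_eq. Qed.
Fact lin_compA (A B C D : lmodType R) (h : {linear C -> D}) (g : {linear B -> C})
  (f : {linear A -> B}) : lin_comp h (lin_comp g f) = lin_comp (lin_comp h g) f.
Proof. exact: linear_eq. Qed.
Fact lin_compBl (A B C : lmodType R) (g g' : {linear B -> C}) (f : {linear A -> B}) :
  lin_comp (g - g') f = lin_comp g f - lin_comp g' f.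
Proof. exact: linear_eq. Qed.
Fact lin_compBr (A B C : lmodType R) (g : {linear B -> C}) (f f' : {linear A -> B}) :
  lin_comp g (f - f') = lin_comp g f - lin_comp g f'.
Proof. by apply: linear_eq => x; apply: (raddfB g). Qed.

Definition Mod : precat :=
  @Precat (lmodType R) (fun A B => {linear A -> B}) (@lin_id R) (@lin_comp R)
    lin_comp1l lin_comp1r lin_compA lin_compBl lin_compBr.

(* For [M] the regular module, [Add_cat M] is the category of projective modules. *)
Definition Add_cat (M : lmodType R) : precat := full_sub (C := Mod) (in_Add M).
Definition Add0_cat (M : lmodType R) : precat := full_sub (C := Mod) (in_Add0 M).

Section IdealJ.
Variable X : lmodType R.

Section Sum.
Variables I K : Type.

Definition dsum_pair_fun (x : dsum I X * dsum K X) (i : I + K) : X :=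
  match i with inl i => x.1 i | inr k => x.2 k end.
Fact dsum_pair_supp x : dsum_pair_fun x \in @fin_supp R (I + K)%type X.
Proof.
case: x => -[f ff] [g gg]; apply/asboolP.
apply: (@sub_finite_set _ _ (inl @` [set i | f i != 0] `|`
   inr @` [set i | g i != 0])%classic).
  by move=> [i|k] /= h; [left; exists i | right; exists k].
by rewrite finite_setU; split; apply: finite_image; apply/asboolP.
Qed.
Definition dsum_pair (x : dsum I X * dsum K X) : dsum (I + K) X :=
  DSum (dsum_pair_supp x).
Fact dsum_pair_is_linear : linear dsum_pair.
Proof. by move=> a x y; apply: dsumE => -[i|k]. Qed.
HB.instance Definition _ := GRing.isLinear.Build R (dsum I X * dsum K X)%type
  (dsum (I + K) X) *:%R dsum_pair dsum_pair_is_linear.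
End Sum.

Section Comap.
Variables (I K : Type) (k : I -> K) (k_inj : injective k).
Fact dsum_comap_supp (x : dsum K X) : (fun i => x (k i)) \in @fin_supp R I X.
Proof.
case: x => f /= /asboolP ff; apply/asboolP.
by apply: (@finite_preimage _ _ [set i | f i != 0] k) => // i j _ _; apply: k_inj.
Qed.
Definition dsum_comap (x : dsum K X) : dsum I X := DSum (dsum_comap_supp x).
Fact dsum_comap_is_linear : linear dsum_comap.
Proof. by move=> a x y; apply: dsumE. Qed.
HB.instance Definition _ := GRing.isLinear.Build R (dsum K X) (dsum I X) *:%R
  dsum_comap dsum_comap_is_linear.
End Comap.

Definition factJ_pred (A B : lmodType R) : {pred {linear A -> B}} :=
  fun f => `[< factJ X A B f >].

Fact factJ_zmod_closed A B : zmod_closed (@factJ_pred A B).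
Proof.
split=> [|f f' /asboolP[I [g [h fE]]] /asboolP[K [g' [h' fE']]]]; apply/asboolP.
  by exists False, 0, 0.
have il : injective (@inl I K) by move=> ? ? [].
have ir : injective (@inr I K) by move=> ? ? [].
pose p (a : A) : dsum I X * dsum K X := (g a, g' a).
have p_lin : linear p by move=> a x y; rewrite /p !linearP.
pose pL : {linear A -> (dsum I X * dsum K X)%type} :=
  HB.pack p (GRing.isLinear.Build _ _ _ _ p p_lin).
exists (I + K)%type, (lin_comp (@dsum_pair I K) pL),
  (lin_comp h (dsum_comap il) - lin_comp h' (dsum_comap ir)).
move=> x; rewrite lin_subE fE fE'.
have -> : (h \o g) x = h (dsum_comap il (dsum_pair (p x))) by congr (h _); apply: dsumE.
have -> // : (h' \o g') x = h' (dsum_comap ir (dsum_pair (p x))).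
by congr (h' _); apply: dsumE.
Qed.
HB.instance Definition _ (A B : lmodType R) := GRing.isZmodClosed.Build {linear A -> B}
  (@factJ_pred A B) (@factJ_zmod_closed A B).

Fact factJMl (A B C : Mod) (g : hom B C) (f : hom A B) :
  f \in @factJ_pred A B -> g \oc f \in @factJ_pred A C.
Proof.
move=> /asboolP[I [p [q fE]]]; apply/asboolP; exists I, p, (lin_comp g q).
by move=> x; rewrite /= fE.
Qed.
Fact factJMr (A B C : Mod) (g : hom B C) (f : hom A B) :
  g \in @factJ_pred B C -> g \oc f \in @factJ_pred A C.
Proof.
move=> /asboolP[I [p [q gE]]]; apply/asboolP; exists I, (lin_comp p f), q.
by move=> x; rewrite /= gE.
Qed.

Definition idealJ : catideal Mod :=
  @CatIdeal Mod (fun A B => @factJ_pred A B) factJMl factJMr.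
End IdealJ.
End ModuleCategory.

Definition Add_quot (R : pzRingType) (M X : lmodType R) : precat :=
  quot_cat (ideal_restrict (idealJ X) (in_Add M)).
Definition Add0_quot (R : pzRingType) (M X : lmodType R) : precat :=
  quot_cat (ideal_restrict (idealJ X) (in_Add0 M)).

Section HomTensor.
Variables (R : pzRingType) (M : rmodType R) (I : bideal (endring M)).

Definition homtens (B : rmodType R) : rmodType (qring I) :=
  tens_quo I {linear M -> B}.

Definition homtens_map (A B : rmodType R) (g : {linear A -> B}) :
  {linear homtens A -> homtens B} := tens_map I (hom_post M g).

Fact homtens_mapB (A B : rmodType R) : zmod_morphism (@homtens_map A B).
Proof.
move=> g g'; apply/linear_eq/tens_ext; try exact: raddfB.
move=> f b; rewrite lin_subE /= !tens_map_pure.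
rewrite -[pure _ _ in LHS](addrK (pure (hom_post M g' f) b)) -pureDl.
congr (pure _ _ - _); apply: linear_eq => x /=; apply: subrK.
Qed.
Fact homtens_map1 (A : rmodType R) : homtens_map (lin_id A) = lin_id (homtens A).
Proof.
apply/linear_eq/tens_ext; try exact: raddfB.
by move=> f b; rewrite /= tens_map_pure; congr pure; apply: linear_eq.
Qed.
Fact homtens_mapM (A B C : rmodType R) (g : {linear B -> C}) (f : {linear A -> B}) :
  homtens_map (lin_comp g f) = lin_comp (homtens_map g) (homtens_map f).
Proof.
apply/linear_eq/tens_ext; try exact: raddfB.
by move=> h b; rewrite /= !tens_map_pure; congr pure; apply: linear_eq.
Qed.

(* [Hom_R(M,-) (x)_S S/I] with [S = End_R(M)]. *)
Definition homtens_functor : functor (Mod R^c) (Mod (qring I)^c) :=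
  @Functor (Mod R^c) (Mod (qring I)^c) homtens homtens_map
    homtens_mapB homtens_map1 homtens_mapM.
End HomTensor.

(* Main.v *)
Require Import Defs.
From HB Require Import structures.
From mathcomp Require Import all_boot all_order all_algebra.
From mathcomp Require Import all_classical.

Set Implicit Arguments.
Unset Strict Implicit.
Unset Printing Implicit Defensive.

Import GRing.Theory.
Local Open Scope ring_scope.

(** Write [S] for the endomorphism ring of [M], [P] for Hom(M,X), [I] for the
trace ideal of [P], [J] for the ideal of maps factoring through direct sums of
copies of [X], and [F] for Hom(M,-) (x) S/I.  Since [M] is finitely generated,
a map from [M] to a direct sum meets finitely many summands
([fg_dsum_decomp]); nearly everything rests on this.

Part (i).  A map from [M] to a direct sum of copies of [X] and on to [B] is a
finite sum of maps M -> X -> B, hence factors through a finite power of [X].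
When [X] is a retract of a direct sum of copies of [M], every [S]-linear map
from [P] to [S] is composition with a map X -> M ([trace_functional]), so the
trace ideal consists of the finite sums of maps M -> X -> M ([trace_factJ]).
Inserting the decomposition of the identity of [X] through copies of [M] into
M -> X -> B turns it into an element of Hom(M,B) I ([mod_ideal_factJ]).

Part (ii), full faithfulness.  Every element of F(B) is [pure b 1], and it is
zero exactly when [b] is in Hom(M,B) I, that is, in J(M,B).  A map out of a
direct sum of copies of [M] is a family of maps out of [M], and [F] carries
that direct sum to the direct sum of copies of S/I; both the surjectivity of
[F] on maps ([homtens_full]) and the description of its kernel
([homtens_faithful]) can therefore be checked on single copies of [M], and they
pass to retracts.

Part (ii), essential surjectivity.  A projective S/I-module is a retract of
F(A) for a direct sum [A] of copies of [M], so it is cut out by F(f) where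
[f - f^2] lies in [J], say [f - f^2 = h g] with [g : A -> Y], [h : Y -> A] and
[Y] a direct sum of copies of [X].  It remains to split [f] modulo [J] inside
Add(M).  The idempotent [f] need not lift to an idempotent of [A], but its
telescope is still a direct summand.  The colimit [B] of the system
A -> A + Y -> A + Y^2 -> ..., where each map applies [f] to the component in
[A] and records [g] of it in a new copy of [Y], is the cokernel of

  A[t] -> A[t] + Y[t],   a |-> (a - t f(a), - g(a)),

and the relation [f - f^2 = h g] supplies an explicit retraction of this map
([tele_retrK]).  So [B] is a summand of A[t] + Y[t], which is in Add(M).
Modulo [J] the modules A + Y^n reduce to [A] and all maps of the system to
[f], so [B] is the image of [f] ([split_to_from]).

Part (iii).  The construction only uses countably many copies of [A] and [Y].
The image of a countably generated module in a direct sum meets countably many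
summands, so one may take countable sums for [A] and [Y], and then [B] is countably
generated. *)

Local Notation hom := Defs.hom.
Local Notation fmap := Defs.fmap.
Local Notation compA := Defs.compA.

(** * Direct sums of copies of a module *)

Definition mklin (R : pzRingType) (U V : lmodType R) (f : U -> V)
  (lf : linear f) : {linear U -> V} :=
  HB.pack f (GRing.isLinear.Build R U V *:%R f lf).

Lemma linear_of_zmod (R : pzRingType) (U V : lmodType R) (f : U -> V) :
  zmod_morphism f -> (forall a x, f (a *: x) = a *: f x) -> linear f.
Proof.
move=> fB fZ a x y; have f0 : f 0 = 0 by rewrite -(subrr 0) fB subrr.
by rewrite -{1}[y]opprK fB fZ -[- y]sub0r fB f0 sub0r opprK.
Qed.

Lemma lin_congr (R : pzRingType) (U V : lmodType R) (f g : {linear U -> V}) :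
  f = g -> f =1 g.
Proof. by move->. Qed.

Section DirectSumMaps.
Variables (R : pzRingType) (I : Type) (N : lmodType R).
Implicit Types (x y : dsum I N) (i j : I).

Definition dsum_inj_fun i (a : N) : I -> N :=
  fun j => if `[< j = i >] then a else 0.

Fact dsum_inj_supp i a : dsum_inj_fun i a \in @fin_supp R I N.
Proof.
apply/asboolP; apply: (@sub_finite_set _ _ [set i]%classic) => // j /=.
by rewrite /dsum_inj_fun; case: asboolP => // _; rewrite eqxx.
Qed.

Fact dsum_inj_is_linear i : linear (fun a => DSum (dsum_inj_supp i a)).
Proof.
move=> c a b; apply: dsumE => j /=; rewrite /dsum_inj_fun /=.
change (dsum_inj_fun i (c *: a + b) j
   = c *: dsum_inj_fun i a j + dsum_inj_fun i b j).
by rewrite /dsum_inj_fun; case: asboolP => // _; rewrite scaler0 addr0.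
Qed.
(** Locked, like [dsum_lift] below, so that simplification does not expose the
underlying functions: proofs go through [dsum_lift_inj] and [dsum_ext]. *)
Definition dsum_inj i : {linear N -> dsum I N} :=
  locked (mklin (dsum_inj_is_linear i)).

Fact dsum_proj_is_linear i : linear (fun x => x i).
Proof. by []. Qed.
Definition dsum_proj i : {linear dsum I N -> N} := mklin (dsum_proj_is_linear i).

Lemma dsum_injE i a : dsum_inj i a i = a.
Proof. by rewrite /dsum_inj -lock /= /dsum_inj_fun; case: asboolP. Qed.

Lemma dsum_injNE i j a : j <> i -> dsum_inj i a j = 0.
Proof. by rewrite /dsum_inj -lock /= /dsum_inj_fun; case: asboolP. Qed.

Lemma dsum_sumE (J : Type) (r : seq J) (P : pred J) (F : J -> dsum I N) i :
  (\sum_(k <- r | P k) F k) i = \sum_(k <- r | P k) F k i.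
Proof. exact: (raddf_sum (dsum_proj i)). Qed.

(** The index type has no decidable equality; [{classic I}] supplies one, which
is what membership in a sequence and its uniqueness require. *)
Definition covers (s : seq {classic I}) x :=
  uniq s /\ forall i, x i != 0 -> (i : {classic I}) \in s.

Lemma ex_cover x : exists s, covers s x.
Proof.
have /asboolP : dsum_val x \in @fin_supp R I N by case: x.
move=> /(@finite_seqP {classic I})[s sE]; exists (undup s); split.
  exact: undup_uniq.
by move=> i xi; rewrite mem_undup; have : [set` s]%classic i by rewrite -sE.
Qed.

Definition dsupp x : seq {classic I} := sval (cid (ex_cover x)).
Lemma dsuppP x : covers (dsupp x) x. Proof. exact: (svalP (cid (ex_cover x))). Qed.

(** Indices outside the support contribute nothing, so sums over the support may
be computed over any larger finite set; this makes [dsum_lift_fun] linear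
although it is defined from chosen covers. *)
Lemma cover_sum (V : zmodType) x s t (F : I -> V) :
  covers s x -> covers t x -> (forall i, x i = 0 -> F i = 0) ->
  \sum_(i <- s) F i = \sum_(i <- t) F i.
Proof.
move=> [us cs] [ut ct] F0.
have red (r : seq {classic I}) :
    \sum_(i <- r) F i = \sum_(i <- [seq i <- r | x (i : I) != 0]) F i.
  rewrite big_filter (bigID (fun i : {classic I} => x (i : I) != 0)) /=.
  rewrite [X in _ + X]big1 ?addr0 // => i; rewrite negbK => /eqP; exact: F0.
rewrite (red s) (red t); apply: (@perm_big _ _ _ {classic I}); apply: uniq_perm.
- exact: filter_uniq.
- exact: filter_uniq.
move=> i; rewrite !mem_filter; case xi: (x (i : I) != 0) => //=.
by rewrite cs ?ct ?xi.
Qed.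

Lemma dsum_cover x s : covers s x -> x = \sum_(i <- s) dsum_inj i (x i).
Proof.
move=> [us cs]; apply: dsumE => j; rewrite dsum_sumE.
have [xj|xj] := eqVneq (x j) 0.
  rewrite xj big1_seq // => i _.
  have [->|/eqP/nesym ij] := eqVneq (i : {classic I}) j; first by rewrite dsum_injE.
  by rewrite dsum_injNE.
rewrite (bigD1_seq (j : {classic I})) ?cs // dsum_injE big1 ?Monoid.mulm1 // => i.
by move=> /eqP/nesym ij; rewrite dsum_injNE.
Qed.

Lemma dsum_ind (Q : dsum I N -> Prop) :
  Q 0 -> (forall x y, Q x -> Q y -> Q (x + y)) ->
  (forall i a, Q (dsum_inj i a)) -> forall x, Q x.
Proof.
move=> Q0 QD Qi x; rewrite (dsum_cover (dsuppP x)).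
by elim/big_ind: _ => // i _.
Qed.

Lemma dsum_ext (L : lmodType R) (f g : {linear dsum I N -> L}) :
  (forall i a, f (dsum_inj i a) = g (dsum_inj i a)) -> f = g.
Proof.
move=> fg; apply/linear_eq; elim/dsum_ind => [|x y fx fy|//]; first by rewrite !linear0.
by rewrite !linearD fx fy.
Qed.

Section Lift.
Variables (L : lmodType R) (F : I -> {linear N -> L}).

Definition dsum_lift_fun x : L := \sum_(i <- dsupp x) F i (x i).

Lemma dsum_lift_cover x s : covers s x -> dsum_lift_fun x = \sum_(i <- s) F i (x i).
Proof.
by move=> cs; apply: (cover_sum (dsuppP x) cs) => i ->; rewrite linear0.
Qed.

Fact dsum_lift_is_linear : linear dsum_lift_fun.
Proof.
move=> c x y; pose s := undup (dsupp x ++ dsupp y).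
have [_ cx] := dsuppP x; have [_ cy] := dsuppP y.
have sx : covers s x.
  by split=> [|i /cx xi]; rewrite ?undup_uniq // mem_undup mem_cat xi.
have sy : covers s y.
  by split=> [|i /cy yi]; rewrite ?undup_uniq // mem_undup mem_cat yi orbT.
have sxy : covers s (c *: x + y).
  split=> [|i]; first exact: undup_uniq.
  change ((c *: x + y) i) with (c *: x i + y i).
  have [xi|/cx xi _] := eqVneq (x i) 0.
    rewrite xi scaler0 add0r => /cy yi.
    by rewrite mem_undup mem_cat yi orbT.
  by rewrite mem_undup mem_cat xi.
rewrite (dsum_lift_cover sx) (dsum_lift_cover sy) (dsum_lift_cover sxy).
rewrite scaler_sumr -big_split; apply: eq_bigr => i _ /=.
by rewrite -linearP.
Qed.
Definition dsum_lift : {linear dsum I N -> L} :=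
  locked (mklin dsum_lift_is_linear).

Lemma dsum_lift_inj i a : dsum_lift (dsum_inj i a) = F i a.
Proof.
rewrite /dsum_lift -lock /= (@dsum_lift_cover _ [:: i]); first by rewrite big_seq1 dsum_injE.
split=> // j; rewrite inE; case: (eqVneq (j : {classic I}) i) => // /eqP ij.
by rewrite dsum_injNE // eqxx.
Qed.
End Lift.

End DirectSumMaps.

Section DirectSumFunctor.
Variable R : pzRingType.

Definition dsum_map (I : Type) (N L : lmodType R) (f : {linear N -> L}) :
  {linear dsum I N -> dsum I L} :=
  dsum_lift (fun i => lin_comp (dsum_inj L i) f).

Lemma dsum_map_inj (I : Type) (N L : lmodType R) (f : {linear N -> L}) (i : I) a :
  dsum_map I f (dsum_inj N i a) = dsum_inj L i (f a).
Proof. by rewrite /dsum_map dsum_lift_inj. Qed.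

Lemma dsum_map_comp (I : Type) (N L K : lmodType R) (g : {linear L -> K})
  (f : {linear N -> L}) :
  dsum_map I (lin_comp g f) = lin_comp (dsum_map I g) (dsum_map I f).
Proof. by apply: dsum_ext => i a; rewrite /= !dsum_map_inj. Qed.

Lemma dsum_map_id (I : Type) (N : lmodType R) : dsum_map I (lin_id N) = lin_id _.
Proof. by apply: dsum_ext => i a; rewrite dsum_map_inj. Qed.

Definition dsum_flatten (I K : Type) (N : lmodType R) :
  {linear dsum I (dsum K N) -> dsum (I * K) N} :=
  dsum_lift (fun i => dsum_lift (fun k => dsum_inj N (i, k))).

Definition dsum_nest (I K : Type) (N : lmodType R) :
  {linear dsum (I * K) N -> dsum I (dsum K N)} :=
  dsum_lift (fun ik => lin_comp (dsum_inj (dsum K N) ik.1) (dsum_inj N ik.2)).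

Lemma dsum_flattenK (I K : Type) (N : lmodType R) :
  lin_comp (@dsum_nest I K N) (@dsum_flatten I K N) = lin_id _.
Proof.
apply: dsum_ext => i; apply: (@lin_congr _ _ _ (lin_comp _ _) (dsum_inj _ i)).
apply: dsum_ext => k a.
by rewrite /= /dsum_flatten dsum_lift_inj /= dsum_lift_inj /dsum_nest dsum_lift_inj.
Qed.

End DirectSumFunctor.

Section FiniteDecomposition.
Variables (R : pzRingType) (M : lmodType R) (M_fg : fin_generated M).

(** The supports of the images of the generators together form a finite set. *)
Lemma fg_dsum_decomp (I : Type) (N : lmodType R) (f : {linear M -> dsum I N}) :
  exists s : seq I,
    f = \sum_(i <- s) lin_comp (dsum_inj N i) (lin_comp (dsum_proj N i) f).
Proof.
have [n [e eP]] := M_fg.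
pose s : seq {classic I} := undup (flatten [seq dsupp (f (e k)) | k <- enum 'I_n]).
have cov k : covers s (f (e k)).
  split=> [|i fi]; first exact: undup_uniq.
  rewrite mem_undup; apply/flattenP; exists (dsupp (f (e k))).
    by apply/mapP; exists k; rewrite ?mem_enum.
  by have [_] := dsuppP (f (e k)); apply.
exists s; apply/linear_eq => x; have [c ->] := eP x.
rewrite !linear_sum; apply: eq_bigr => k _; rewrite !linearZ; congr (_ *: _).
by rewrite lin_sumE {1}(dsum_cover (cov k)).
Qed.

End FiniteDecomposition.

(** * Kernels, retracts and countable generation *)

Section Kernel.
Variables (R : pzRingType) (U V : lmodType R) (f : {linear U -> V}).

Definition in_ker : {pred U} := fun x => f x == 0.
Fact in_ker_closed : submod_closed in_ker.
Proof.
split=> [|a x y /eqP fx /eqP fy]; apply/eqP; first exact: linear0.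
by rewrite linearP fx fy scaler0 addr0.
Qed.
HB.instance Definition _ := GRing.isSubmodClosed.Build R U in_ker in_ker_closed.

Record kernel := Kernel { ker_val : U; _ : ker_val \in in_ker }.
HB.instance Definition _ := [isSub for ker_val].
HB.instance Definition _ := [Choice of kernel by <:].
HB.instance Definition _ := [SubChoice_isSubLmodule of kernel by <:].

Lemma ker_valP (x : kernel) : f (ker_val x) = 0.
Proof. by case: x => x fx; apply/eqP. Qed.

Fact ker_val_is_linear : linear ker_val. Proof. by []. Qed.
Definition ker_incl : {linear kernel -> U} := mklin ker_val_is_linear.

Section Corestriction.
Variables (W : lmodType R) (g : {linear W -> U}) (fg : forall x, f (g x) = 0).

Fact ker_lift_subproof x : g x \in in_ker. Proof. exact/eqP. Qed.
Fact ker_lift_is_linear : linear (fun x => Kernel (ker_lift_subproof x)).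
Proof. by move=> a x y; apply: val_inj => /=; rewrite linearP. Qed.
Definition ker_lift : {linear W -> kernel} := mklin ker_lift_is_linear.
End Corestriction.
End Kernel.

Section Retracts.
Variable R : pzRingType.
Implicit Types A B C M N L : lmodType R.

Definition retract B N :=
  exists (s : {linear B -> N}) (r : {linear N -> B}), forall x, r (s x) = x.

Lemma retract_trans B N L : retract B N -> retract N L -> retract B L.
Proof.
move=> [s [r rs]] [s' [r' rs']]; exists (lin_comp s' s), (lin_comp r r').
by move=> x; rewrite /= rs' rs.
Qed.

Lemma iso_retract B N : isomorphic B N -> retract B N.
Proof.
move=> [f [g fK gK]]; have lg : linear g.
  by move=> a x y; rewrite -[LHS]fK -{1}[x]gK -{1}[y]gK -linearP !fK.
by exists f, (mklin lg).
Qed.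

(** The complement is the kernel of the retraction. Retracts compose at once,
which summands up to isomorphism do not. *)
Lemma iso_summandP B N : iso_summand B N <-> retract B N.
Proof.
split=> [[C /iso_retract]|[s [r rs]]].
  apply: retract_trans.
  have ls : linear (fun b : B => (b, 0 : C)).
    by move=> a x y; congr (_, _); rewrite /= scaler0 addr0.
  have lr : linear (fun z : B * C => z.1) by [].
  by exists (mklin ls), (mklin lr).
pose C := kernel r; exists C.
pose f (z : B * C) := s z.1 + ker_val z.2.
have lf : linear f.
  move=> a x y; rewrite /f /= linearP scalerDr addrACA; congr (_ + _).
have rE x : r (x - s (r x)) = 0 by rewrite raddfB /= rs subrr.
pose g := ker_lift (f := r) (g := lin_id N - lin_comp s r) rE.
exists (mklin lf), (fun x => (r x, g x)) => [[b c]|x] /=; rewrite /f /=.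
  have rb : r (s b + ker_val c) = b by rewrite linearD rs ker_valP addr0.
  congr (_, _); rewrite ?rb //; apply: val_inj.
  change (s b + ker_val c - s (r (s b + ker_val c)) = ker_val c).
  by rewrite rb addrAC subrr add0r.
change (s (r x) + (x - s (r x)) = x); exact: subrKC.
Qed.

Lemma in_AddP M B : in_Add M B <-> exists I : Type, retract B (dsum I M).
Proof. by split=> -[I /iso_summandP]; exists I. Qed.

Lemma retract_in_Add M B N : retract B N -> in_Add M N -> in_Add M B.
Proof.
move=> rBN /in_AddP[I rN]; apply/in_AddP; exists I; exact: retract_trans rN.
Qed.

Lemma retract_dsum I N L : retract N L -> retract (dsum I N) (dsum I L).
Proof.
move=> [s [r rs]]; exists (dsum_map I s), (dsum_map I r).
apply: (lin_congr (f := lin_comp _ _) (g := lin_id _)).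
by rewrite -dsum_map_comp -dsum_map_id; congr dsum_map; apply/linear_eq.
Qed.

Lemma in_Add_dsum M (I : Type) N : in_Add M N -> in_Add M (dsum I N).
Proof.
move=> /in_AddP[K rN]; apply/in_AddP; exists (I * K)%type.
apply: (retract_trans (retract_dsum I rN)).
exists (dsum_flatten I K M), (dsum_nest I K M) => x.
exact: (lin_congr (@dsum_flattenK R I K M) x).
Qed.

Lemma in_Add_self M : in_Add M M.
Proof.
apply/in_AddP; exists unit, (dsum_inj M tt), (dsum_proj M tt) => x.
exact: dsum_injE.
Qed.

Lemma in_Add_prod M N L : in_Add M N -> in_Add M L -> in_Add M (N * L)%type.
Proof.
move=> /in_AddP[I [s [r rs]]] /in_AddP[K [s' [r' rs']]].
apply/in_AddP; exists (I + K)%type.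
have lf : linear (fun z : N * L => dsum_pair (s z.1, s' z.2)).
  by move=> a x y; rewrite -linearP; congr dsum_pair; rewrite /= !linearP.
have il : injective (@inl I K) by move=> ? ? [].
have ir : injective (@inr I K) by move=> ? ? [].
have lg : linear (fun y : dsum (I + K) M =>
    (r (dsum_comap il y), r' (dsum_comap ir y))).
  by move=> a x y; rewrite !linearP.
exists (mklin lf), (mklin lg) => -[x y] /=.
congr (_, _); first by rewrite -[RHS]rs; congr (r _); apply: dsumE.
by rewrite -[RHS]rs'; congr (r' _); apply: dsumE.
Qed.
End Retracts.

Section CountablyGenerated.
Variable R : pzRingType.
Implicit Types A B N L : lmodType R.

Definition lin_inductive N (Q : N -> Prop) :=
  [/\ Q 0, forall x y, Q x -> Q y -> Q (x + y) & forall (a : R) x, Q x -> Q (a *: x)].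

(** Generation as an induction principle: a property closed under linear
combinations and true of the generators holds everywhere. This form transfers
along direct sums and linear images without handling coefficients. *)
Lemma count_generatedP N :
  count_generated N <-> exists e : nat -> N,
    forall Q, lin_inductive Q -> (forall n, Q (e n)) -> forall x, Q x.
Proof.
split=> -[e eP]; exists e.
  move=> Q [Q0 QD QZ] Qe x; have [n [c ->]] := eP x.
  by elim/big_ind: _ => // i _; apply: QZ.
apply: eP.
  split=> [|x y [n [c ->]] [m [d ->]]|a x [n [c ->]]].
  - by exists 0%N, (fun=> 0); rewrite big_ord0.
  - (* padding with zeros makes the two combinations of equal length *)
    pose c' i := if (i < n)%N then c i else 0.
    pose d' i := if (i < m)%N then d i else 0.
    exists (maxn n m), (fun i => c' i + d' i).
    under [RHS]eq_bigr do rewrite scalerDl; rewrite big_split /=; congr (_ + _).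
      rewrite (big_ord_widen _ (fun i => c i *: e i) (leq_maxl n m)).
      rewrite [RHS](bigID (fun i : 'I__ => (i < n)%N)) /= [X in _ + X]big1 ?addr0.
        by apply: eq_bigr => i; rewrite /c' => ->.
      by move=> i; rewrite /c' => /negbTE ->; rewrite scale0r.
    rewrite (big_ord_widen _ (fun i => d i *: e i) (leq_maxr n m)).
    rewrite [RHS](bigID (fun i : 'I__ => (i < m)%N)) /= [X in _ + X]big1 ?addr0.
      by apply: eq_bigr => i; rewrite /d' => ->.
    by move=> i; rewrite /d' => /negbTE ->; rewrite scale0r.
  - exists n, (fun i => a * c i); rewrite scaler_sumr.
    by apply: eq_bigr => i _; rewrite scalerA.
move=> n; exists n.+1, (fun i => if i == n then 1 else 0).
rewrite big_ord_recr /= eqxx scale1r big1 ?add0r // => i _.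
by rewrite ltn_eqF // scale0r.
Qed.

Lemma lin_inductive_comap N L (f : {linear N -> L}) (Q : L -> Prop) :
  lin_inductive Q -> lin_inductive (fun x => Q (f x)).
Proof.
move=> [Q0 QD QZ]; split=> [|x y Qx Qy|a x Qx]; first by rewrite linear0.
  by rewrite linearD; apply: QD.
by rewrite linearZ; apply: QZ.
Qed.

Lemma retract_count_generated B N :
  retract B N -> count_generated N -> count_generated B.
Proof.
move=> [s [r rs]] /count_generatedP[e eP]; apply/count_generatedP.
exists (r \o e) => Q Ql Qe x; rewrite -[x]rs.
exact: (eP _ (lin_inductive_comap r Ql)).
Qed.

Lemma count_generated_dsum N : count_generated N -> count_generated (dsum nat N).
Proof.
move=> /count_generatedP[e eP]; apply/count_generatedP.
exists (fun p => if unpickle p is Some (n, m) then dsum_inj N n (e m) else 0).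
move=> Q Ql Qe; have [Q0 QD _] := Ql; elim/dsum_ind => // n.
apply: (eP _ (lin_inductive_comap _ Ql)) => m.
by have := Qe (pickle (n, m)); rewrite pickleK.
Qed.

Lemma count_generated_prod N L :
  count_generated N -> count_generated L -> count_generated (N * L)%type.
Proof.
move=> /count_generatedP[e eP] /count_generatedP[d dP]; apply/count_generatedP.
exists (fun p => if unpickle p is Some (b, n) then
   if b then (e n, 0) else (0, d n) else 0).
move=> Q Ql Qe; have [Q0 QD QZ] := Ql; move=> [x y].
have -> : (x, y) = (x, 0) + (0, y) :> N * L by congr (_, _); rewrite /= ?addr0 ?add0r.
apply: (QD).
  elim/eP: x => [|n]; last by have := Qe (pickle (true, n)); rewrite pickleK.
  split=> // [x x' Qx Qx'|a x Qx].
    have -> : (x + x', 0) = (x, 0) + (x', 0) :> N * L by congr (_, _); rewrite /= addr0.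
    exact: QD.
  have -> : (a *: x, 0) = a *: (x, 0) :> N * L by congr (_, _); rewrite /= scaler0.
  exact: QZ.
elim/dP: y => [|n]; last by have := Qe (pickle (false, n)); rewrite pickleK.
split=> // [x' x'' Qx Qx'|a x' Qx].
  have -> : (0, x' + x'') = (0, x') + (0, x'') :> N * L by congr (_, _); rewrite /= addr0.
  exact: QD.
have -> : (0, a *: x') = a *: (0, x') :> N * L by congr (_, _); rewrite /= scaler0.
exact: QZ.
Qed.

Lemma fg_count_generated N : fin_generated N -> count_generated N.
Proof.
move=> [n [e eP]]; apply/count_generatedP.
exists (fun k => if insub k is Some i then e i else 0) => Q [Q0 QD QZ] Qe x.
have [c ->] := eP x; elim/big_ind: _ => // i _; apply: QZ.
by have := Qe i; rewrite valK.
Qed.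

(** The supports of the images of the generators form a countable set of
indices. The summands in it are enumerated by [k], possibly with repetitions;
[p] sends each one to one of its positions and [j] sends it back. *)
Lemma count_generated_factor B N (I : Type) (f : {linear B -> dsum I N}) :
  count_generated B ->
  exists (p : {linear dsum I N -> dsum nat N}) (j : {linear dsum nat N -> dsum I N}),
    forall x, j (p (f x)) = f x.
Proof.
move=> /count_generatedP[e eP].
pose k q : option I := if unpickle q is Some (n, m)
  then onth (dsupp (f (e n))) m else None.
pose idx (i : I) : nat := if pselect (exists q, k q = Some i) is left ex
  then projT1 (cid ex) else 0%N.
pose j := dsum_lift (fun q => if k q is Some i then dsum_inj N i else 0).
pose p := dsum_lift (fun i => dsum_inj N (idx i)).
have jp i a : (exists q, k q = Some i) -> j (p (dsum_inj N i a)) = dsum_inj N i a.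
  move=> ex; rewrite /p /j !dsum_lift_inj /idx.
  by case: pselect => // ex'; case: cid => q /= ->.
exists p, j; apply: eP => [|n].
  split=> [|x y xE yE|a x xE]; first by rewrite !linear0.
    by rewrite !linearD xE yE.
  by rewrite !linearZ /= xE.
rewrite {1}(dsum_cover (dsuppP (f (e n)))) !linear_sum.
rewrite [RHS](dsum_cover (dsuppP (f (e n)))).
rewrite [LHS]big_seq [RHS]big_seq; apply: eq_bigr => i si; apply: jp.
have /onthP[m mi] := si.
by exists (pickle (n, m)); rewrite /k pickleK.
Qed.

Lemma retract_dsum_nat B N (I : Type) :
  count_generated B -> retract B (dsum I N) -> retract B (dsum nat N).
Proof.
move=> cB [s [r rs]]; have [p [j jp]] := count_generated_factor s cB.
by exists (lin_comp p s), (lin_comp r j) => x; rewrite /= jp rs.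
Qed.
End CountablyGenerated.

(** * The trace ideal and maps factoring through sums of copies of X *)

Section ModIdeal.
Variables (S : pzRingType) (I : bideal S) (N : rmodType S).

Definition mod_ideal_pred : {pred N} :=
  fun x => `[< mod_ideal [set a | a \in I] x >].

Lemma mod_idealP x : mod_ideal [set a | a \in I]%classic x <-> x \in mod_ideal_pred.
Proof. by split=> [?|/asboolP //]; apply/asboolP. Qed.

Fact mod_ideal_zmod_closed : zmod_closed mod_ideal_pred.
Proof.
apply: fsums_zmod_closed => _ [v [a [aI ->]]]; exists (- v), a.
by rewrite scalerN.
Qed.
HB.instance Definition _ := GRing.isZmodClosed.Build N mod_ideal_pred mod_ideal_zmod_closed.

Lemma mod_ideal_scale (J : set S) (a : S) (v : N) : J a -> mod_ideal J ((a : S^c) *: v).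
Proof.
move=> Ja; exists [:: (a : S^c) *: v]; last by rewrite big_seq1.
by move=> y; rewrite inE => /eqP ->; exists v, a.
Qed.
End ModIdeal.

Lemma trace_set (S : pzRingType) (P : rmodType S) :
  trace P = [set a | a \in trace_ideal P]%classic.
Proof. by apply/seteqP; split=> a /asboolP. Qed.

Section FactorIdeals.
Variables (R : pzRingType) (X : lmodType R).
Implicit Types A B M : lmodType R.

Lemma factJP A B (f : {linear A -> B}) : factJ X A B f <-> f \in @factJ_pred R X A B.
Proof. by split=> [?|/asboolP //]; apply/asboolP. Qed.

Lemma factI_factJ A B f : factI X A B f -> factJ X A B f.
Proof.
move=> [n [g [h fE]]]; exists 'I_n.
have supp (y : {ffun 'I_n -> X}) : (fun i => y i) \in @fin_supp R 'I_n X.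
  apply/asboolP; exact: finite_finset.
have lin_to : linear (fun y => DSum (supp y)).
  by move=> a y z; apply: dsumE => i /=; rewrite !ffunE.
have lin_of : linear (fun y : dsum 'I_n X => [ffun i => y i]).
  by move=> a y z; apply/ffunP => i; rewrite !ffunE.
exists (lin_comp (mklin lin_to) g), (lin_comp h (mklin lin_of)) => x.
by rewrite fE /=; congr (h _); apply/ffunP => i; rewrite ffunE.
Qed.

(** Only finitely many summands of the direct sum meet the image of [M]. *)
Lemma factJ_decomp M B f : fin_generated M -> factJ X M B f ->
  exists (n : nat) (p : 'I_n -> {linear M -> X}) (k : 'I_n -> {linear X -> B}),
    f = \sum_i lin_comp (k i) (p i).
Proof.
move=> M_fg [K [g [h fE]]]; have [s gE] := fg_dsum_decomp M_fg g.
exists (size s), (fun i => lin_comp (dsum_proj X (tnth (in_tuple s) i)) g),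
  (fun i => lin_comp h (dsum_inj X (tnth (in_tuple s) i))).
apply/linear_eq => x; rewrite fE {1}gE /= lin_sumE linear_sum lin_sumE.
by rewrite big_tnth.
Qed.

Lemma factJ_factI M B f : fin_generated M -> factJ X M B f -> factI X M B f.
Proof.
move=> M_fg /(factJ_decomp M_fg)[n [p [k fE]]]; exists n.
have lin_to : linear (fun x : M => [ffun i => p i x]).
  by move=> a x y; apply/ffunP => i; rewrite !ffunE linearP.
have lin_of : linear (fun y : {ffun 'I_n -> X} => \sum_i k i (y i)).
  move=> a y z; rewrite scaler_sumr -big_split; apply: eq_bigr => i _ /=.
  by rewrite !ffunE linearP.
exists (mklin lin_to), (mklin lin_of) => x; rewrite fE lin_sumE.
by apply: eq_bigr => i _; rewrite ffunE.
Qed.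
End FactorIdeals.

Section TraceIdeal.
Variables (R : pzRingType) (M X : lmodType R).
Hypotheses (M_fg : fin_generated M) (X_Add : in_Add M X).
Let S : pzRingType := endring M.
Let P : rmodType S := {linear M -> X}.

(** With [r : M^(I) -> X] a retraction, [f] is determined by its values on the
maps [r] o [inj i], because each [p : M -> X] is a finite sum of these maps
precomposed with endomorphisms of [M]. The values assemble to a map from
[M^(I)] to [M], which is restricted to [X]. *)
Lemma trace_functional (f : {linear P -> rregular S}) :
  exists h : {linear X -> M}, forall p : P, f p = lin_comp h p :> S.
Proof.
have [I [s [r rs]]] := (in_AddP M X).1 X_Add.
pose c i : {linear M -> M} := (f (lin_comp r (dsum_inj M i)) : S).
exists (lin_comp (dsum_lift c) s) => p.
have [t spE] := fg_dsum_decomp M_fg (lin_comp s p).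
pose a i : S := lin_comp (dsum_proj M i) (lin_comp s p).
have pE : p = \sum_(i <- t) (a i : S^c) *: (lin_comp r (dsum_inj M i) : P).
  apply/linear_eq => x; rewrite lin_sumE -[LHS]rs.
  have -> : s (p x) = lin_comp s p x by [].
  by rewrite {1}spE lin_sumE linear_sum.
transitivity (\sum_(i <- t) (c i : S) * a i).
  rewrite {1}pE raddf_sum; apply: eq_bigr => i _.
  exact: (linearZ_LR f (a i : S^c) _).
apply/linear_eq => x.
rewrite (lin_sumE t xpredT (fun i => (c i : S) * a i)) -[RHS]/(dsum_lift c (lin_comp s p x)).
rewrite {1}spE lin_sumE linear_sum.
by apply: eq_bigr => i _; rewrite /= dsum_lift_inj.
Qed.

(** By [trace_functional] the generators of the trace ideal are exactly the maps
M -> X -> M. *)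
Lemma trace_factJ (s : S) : trace P s <-> factJ X M M s.
Proof.
split=> [[t tP ->]|].
  apply/factJP; rewrite big_seq; apply: rpred_sum => y /tP[f [p ->]].
  have [h ->] := trace_functional f; apply/factJP.
  exists unit, (lin_comp (dsum_inj X tt) p), (lin_comp h (dsum_proj X tt)) => x.
  by rewrite /= dsum_injE.
move=> /(factJ_decomp M_fg)[n [p [k ->]]].
exists [seq (lin_comp (k i) (p i) : S) | i <- enum 'I_n]; last first.
  by rewrite big_map big_enum.
move=> _ /mapP[i _ ->].
have lk : linear (fun q : P => lin_comp (k i) q : rregular S).
  by move=> a q q'; apply: linear_eq => x; rewrite /= linearD.
by exists (mklin lk), (p i).
Qed.

(** A composite M -> X -> B is rewritten through copies of [M] with
X -> M^(I) -> X; its components M -> X -> M are in the trace ideal. *)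
Lemma mod_ideal_factJ (B : lmodType R) (f : {linear M -> B}) :
  mod_ideal (S := S) (N := {linear M -> B}) (trace P) f <-> factJ X M B f.
Proof.
split=> [[t tP ->]|].
  apply/factJP; rewrite big_seq; apply: rpred_sum => y /tP[v [a [/trace_factJ aJ ->]]].
  by apply: (@factJMl R X M M B); apply/factJP.
move=> /(factJ_decomp M_fg)[n [p [k ->]]].
have [I [s [r rs]]] := (in_AddP M X).1 X_Add.
rewrite trace_set; apply/mod_idealP/rpred_sum => i _; apply/mod_idealP.
have [t spE] := fg_dsum_decomp M_fg (lin_comp s (p i)).
have -> : lin_comp (k i) (p i) = \sum_(l <- t)
    (lin_comp (dsum_proj M l) (lin_comp s (p i)) : S^c) *:
    (lin_comp (lin_comp (k i) r) (dsum_inj M l) : {linear M -> B}).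
  apply/linear_eq => x; rewrite lin_sumE.
  transitivity (k i (r (lin_comp s (p i) x))); first by rewrite /= rs.
  by rewrite {1}spE lin_sumE !linear_sum.
apply/mod_idealP/rpred_sum => l _; apply/mod_idealP; rewrite -trace_set.
apply: mod_ideal_scale; apply/trace_factJ/factJP.
apply: (@factJMl R X M (dsum I M) M); apply/factJP.
exists unit, (lin_comp (dsum_inj X tt) (p i)), (lin_comp s (dsum_proj X tt)) => x.
by rewrite /= dsum_injE.
Qed.
End TraceIdeal.

(** * Full, faithful and essentially surjective functors *)

Section Equivalence.
Variables (C D : precat) (F : functor C D).
Hypotheses (F_inj : forall A B, injective (@fmap C D F A B))
  (F_full : forall A B (g : hom (F A) (F B)), exists f, fmap F f = g)
  (F_ess : forall Y, exists (A : C) (u : hom (F A) Y) (v : hom Y (F A)),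
     v \oc u = idc _ /\ u \oc v = idc _).

Let G0 (Y : D) : C := sval (cid (F_ess Y)).
Let iso_data Y : {uv : hom (F (G0 Y)) Y * hom Y (F (G0 Y)) |
  uv.2 \oc uv.1 = idc _ /\ uv.1 \oc uv.2 = idc _}.
Proof.
apply: cid; rewrite /G0; case: cid => A /= [u [v uv]].
by exists (u, v).
Qed.
Let e Y : hom (F (G0 Y)) Y := (sval (iso_data Y)).1.
Let e' Y : hom Y (F (G0 Y)) := (sval (iso_data Y)).2.
Let e'e Y : e' Y \oc e Y = idc _. Proof. by have [] := svalP (iso_data Y). Qed.
Let ee' Y : e Y \oc e' Y = idc _. Proof. by have [] := svalP (iso_data Y). Qed.

Let pre A B (g : hom (F A) (F B)) : hom A B := sval (cid (F_full g)).
Let preK A B (g : hom (F A) (F B)) : fmap F (pre g) = g.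
Proof. exact: svalP (cid (F_full g)). Qed.

Let G1 Y Z (g : hom Y Z) : hom (G0 Y) (G0 Z) := pre (e' Z \oc g \oc e Y).
Let G1B Y Z : zmod_morphism (@G1 Y Z).
Proof.
by move=> g g'; apply: F_inj; rewrite fmapB !preK compBr compBl.
Qed.
Let G11 Y : G1 (idc Y) = idc (G0 Y).
Proof. by apply: F_inj; rewrite preK comp1r e'e fmap1. Qed.
Let G1M X Y Z (g : hom Y Z) (f : hom X Y) : G1 (g \oc f) = G1 g \oc G1 f.
Proof.
apply: F_inj; rewrite fmapM !preK !compA; congr (_ \oc _ \oc _).
by rewrite -[RHS]compA ee' comp1r.
Qed.
Let G : functor D C := Functor G1B G11 G1M.

Lemma ff_ess_equivalence : is_equivalence F.
Proof.
exists G; split.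
  exists (fun A => pre (e (F A))), (fun A => pre (e' (F A))).
  split=> [A|A|A B f]; apply: F_inj; rewrite !fmapM !preK ?fmap1 ?e'e ?ee' //.
  by rewrite !compA ee' comp1l.
exists e, e'; split=> // A B f; rewrite /= /fcomp_map preK !compA.
by rewrite ee' comp1l.
Qed.
End Equivalence.

(** The same criterion on a quotient category, in terms of the original functor:
faithfulness becomes the statement that the kernel is no larger than [J]. *)
Section InducedEquivalence.
Variables (C D : precat) (J : catideal C) (F : functor C D) (FJ : kills J F).

Lemma induced_equivalence :
  (forall A B (f : hom A B), fmap F f = 0 -> f \in J A B) ->
  (forall A B (g : hom (F A) (F B)), exists f, fmap F f = g) ->
  (forall Y, exists (A : C) (u : hom (F A) Y) (v : hom Y (F A)),
     v \oc u = idc _ /\ u \oc v = idc _) ->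
  is_equivalence (induced FJ).
Proof.
move=> F_inj F_full F_ess; apply: ff_ess_equivalence => //.
  move=> A B f g; rewrite -[f]qliftK -[g]qliftK /= !(ind_map_mor FJ) => fg.
  by apply/qmor_eq/F_inj; rewrite fmapB fg subrr.
move=> A B g; have [f <-] := F_full A B g.
by exists (qmor J f); rewrite /= (ind_map_mor FJ).
Qed.
End InducedEquivalence.

(** * The tensor product with a quotient ring *)

Section TensorQuotientElements.
Variables (S : pzRingType) (I : bideal S) (N : rmodType S).

Lemma pure0 (b : qring I) : pure (0 : N) b = 0.
Proof. by apply: (addrI (pure (0 : N) b)); rewrite -pureDl !addr0. Qed.

Lemma pureN (a : N) (b : qring I) : pure (- a) b = - pure a b.
Proof. by apply/eqP; rewrite -addr_eq0 -pureDl addNr pure0. Qed.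

Lemma pure_suml (T : Type) (r : seq T) (x : T -> N) (b : qring I) :
  pure (\sum_(i <- r) x i) b = \sum_(i <- r) pure (x i) b.
Proof.
by elim: r => [|i r IH]; rewrite ?big_nil ?pure0 // !big_cons pureDl IH.
Qed.

Lemma pure_qproj (a : N) (s : S) : pure a (qproj I s) = pure ((s : S^c) *: a) (1 : qring I).
Proof. by rewrite pure_balanced /=; congr pure; rewrite -[LHS]mulr1. Qed.

Lemma tens_quo_pure1 (y : tens_quo I N) : exists x : N, y = pure x (1 : qring I).
Proof.
move: y; apply: tens_ind => [|y z [a ->] [b ->]|a b].
- by exists 0; rewrite pure0.
- by exists (a - b); rewrite pureDl pureN.
- by exists ((qring_repr b : S^c) *: a); rewrite -pure_qproj qprojK.
Qed.

(** The balanced map [N] x S/I -> N/NI, which detects the vanishing of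
[pure x 1]. *)
Definition quo_act (a : N) (b : qring I) : Quotient.quot (@mod_ideal_pred S I N) :=
  qpi (@mod_ideal_pred S I N) ((qring_repr b : S^c) *: a).

Fact quo_act_qproj a s : quo_act a (qproj I s) = qpi (@mod_ideal_pred S I N) ((s : S^c) *: a).
Proof.
apply/qpi_eq/mod_idealP; rewrite -scalerBl; apply: mod_ideal_scale.
exact: repr_qpi.
Qed.

Fact quo_act_balanced : balanced quo_act.
Proof.
split=> [a a' b|a b b'|a s b].
- by rewrite /quo_act scalerDr raddfD.
- rewrite -[b]qprojK -[b']qprojK -raddfD !quo_act_qproj -raddfD.
  by rewrite -scalerDl.
- rewrite -[b]qprojK; have -> : s *: qproj I (qring_repr b) = qproj I (s * qring_repr b).
    by rewrite rmorphM.
  by rewrite !quo_act_qproj scalerA.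
Qed.

Lemma pure1_eq0 (x : N) :
  pure x (1 : qring I) = 0 <-> mod_ideal [set a | a \in I]%classic x.
Proof.
split=> [x0|[s sP ->]].
  have := congr1 (tens_lift quo_act) x0.
  rewrite tens_lift_pure; last exact: quo_act_balanced.
  rewrite (quo_act_qproj x 1) scale1r.
  have -> : tens_lift quo_act 0 = 0.
    rewrite -(subrr (0 : tens N (qring I))) tens_lift_is_zmod_morphism ?subrr //.
    exact: quo_act_balanced.
  by move=> /qpi_eq0/mod_idealP.
rewrite big_seq; elim/big_rec: _ => [|y z /sP[v [a [aI ->]]] z0]; first exact: pure0.
rewrite pureDl z0 addr0 -pure_qproj.
have -> : qproj I a = 0 by apply/qpi_eq0.
by apply: (addrI (pure v (0 : qring I))); rewrite -pureDr !addr0.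
Qed.

Fact pure_is_linear (x : N) :
  linear (fun b : rregular (qring I) => pure x (b : qring I) : tens_quo I N).
Proof.
move=> t b c; rewrite pureDr; congr (_ + _).
by rewrite -[RHS]/(tens_act t (pure x (b : qring I))) tens_act_pure.
Qed.
Definition pure_lin (x : N) : {linear rregular (qring I) -> tens_quo I N} :=
  mklin (pure_is_linear x).

Lemma pure_linE (x : N) (b : qring I) : pure x b = (b : (qring I)^c) *: (pure x (1 : qring I) : tens_quo I N).
Proof. by rewrite -[RHS]/(tens_act b (pure x (1 : qring I))) tens_act_pure mul1r. Qed.
End TensorQuotientElements.

Section HomTensorAdd.
Variables (R : pzRingType) (M : rmodType R) (K : bideal (endring M)).
Hypothesis M_fg : fin_generated M.
Let S : pzRingType := endring M.
Local Notation SK := (rregular (qring K)).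
Local Notation F := (homtens K).

Lemma homtens_map_pure (A B : rmodType R) (f : {linear A -> B}) (a : {linear M -> A}) c :
  homtens_map K f (pure a c) = pure (lin_comp f a) c.
Proof. exact: tens_map_pure. Qed.

Lemma homtens_ext (B : rmodType R) (W : Type) (f g : F B -> W) :
  (forall x : {linear M -> B}, f (pure x (1 : qring K)) = g (pure x (1 : qring K))) -> f =1 g.
Proof. move=> fg y; have [x ->] := tens_quo_pure1 (y : tens_quo K _). exact: fg. Qed.

Section DirectSum.
Variable I : Type.

Lemma fg_comp_supp (f : {linear M -> dsum I M}) :
  finite_set [set i | lin_comp (dsum_proj M i) f != 0].
Proof.
have [s fE] := fg_dsum_decomp M_fg f.
apply: (@sub_finite_set _ _ [set` (s : seq {classic I})]); last exact: finite_seq.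
move=> i /=; apply: contraNT => si; apply/eqP/linear_eq => x.
rewrite fE /= lin_sumE dsum_sumE (@big1_seq _ _ _ {classic I}) // => j js /=.
by rewrite dsum_injNE // => ij; move: si; rewrite ij; case/andP: js => _ ->.
Qed.

(** The [i]-th coordinate of [f (x) c]: the image in [S/K] of the [i]-th
component of [f], times [c]. *)
Definition homtens_coord_fun (f : {linear M -> dsum I M}) (c : qring K) (i : I) : SK :=
  qproj K (lin_comp (dsum_proj M i) f : S) * c.

Fact homtens_coord_supp f c :
  homtens_coord_fun f c \in @fin_supp (qring K)^c I SK.
Proof.
apply/asboolP; apply: sub_finite_set (fg_comp_supp f) => i /=.
by apply: contraNN => /eqP f0; rewrite /homtens_coord_fun f0 raddf0 mul0r.
Qed.
Definition homtens_coord f c : dsum I SK := DSum (homtens_coord_supp f c).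

Fact homtens_coord_balanced : balanced homtens_coord.
Proof.
split=> [f g c|f c d|f s c]; apply: dsumE => i.
- apply: (etrans _ (@mulrDl (qring K) _ _ _)); rewrite -raddfD.
  by congr (qproj K _ * _); apply: linear_eq => x.
- exact: (@mulrDr (qring K)).
- rewrite /= /homtens_coord_fun -[RHS]/(_ * (qproj K s * c)) mulrA -rmorphM.
  by congr (qproj K _ * _); apply: linear_eq => x.
Qed.

Fact homtens_dsum_to_is_linear :
  linear (tens_lift homtens_coord : F (dsum I M) -> dsum I SK).
Proof.
apply: linear_of_zmod => [|t].
  exact: tens_lift_is_zmod_morphism homtens_coord_balanced.
apply: homtens_ext => f.
rewrite -[t *: _]/(tens_act t (pure f (1 : qring K))) tens_act_pure !tens_lift_pure;
  try exact: homtens_coord_balanced.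
by apply: dsumE => i; rewrite /= /homtens_coord_fun mulrA.
Qed.
Definition homtens_dsum_to : {linear F (dsum I M) -> dsum I SK} :=
  mklin homtens_dsum_to_is_linear.

Definition homtens_dsum_of : {linear dsum I SK -> F (dsum I M)} :=
  dsum_lift (fun i => pure_lin K (dsum_inj M i)).

(** [F] sends [M] to [S/K], and finite generation of [M] makes it commute with
direct sums. *)
Lemma homtens_dsum_ofK : cancel homtens_dsum_of homtens_dsum_to.
Proof.
suff /lin_congr : lin_comp homtens_dsum_to homtens_dsum_of = lin_id _ by [].
apply: dsum_ext => i c.
rewrite /= /homtens_dsum_of dsum_lift_inj /= tens_lift_pure; last exact: homtens_coord_balanced.
apply: dsumE => j; rewrite /= /homtens_coord_fun.
have [->|/eqP/nesym ij] := eqVneq (i : {classic I}) j.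
  rewrite dsum_injE; apply: (etrans _ (@mul1r (qring K) c)).
  congr (_ * _); apply: (etrans _ (rmorph1 (qproj K))); congr (qproj K _).
  by apply: linear_eq => x; apply: dsum_injE.
rewrite dsum_injNE //; apply: (etrans _ (@mul0r (qring K) c)).
congr (_ * _); apply: (etrans _ (raddf0 (qproj K))); congr (qproj K _).
by apply: linear_eq => x; apply: dsum_injNE.
Qed.

Lemma homtens_dsum_toK : cancel homtens_dsum_to homtens_dsum_of.
Proof.
apply: (homtens_ext (f := homtens_dsum_of \o homtens_dsum_to) (g := id)) => f; have [s fE] := fg_dsum_decomp M_fg f.
rewrite -[LHS]/(homtens_dsum_of (homtens_dsum_to _)).
rewrite {1 2}fE pure_suml.
pose y i : F (dsum I M) :=
  pure (lin_comp (dsum_inj M i) (lin_comp (dsum_proj M i) f)) (1 : qring K).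
rewrite -[RHS]/(\sum_(i <- s) y i) -[X in homtens_dsum_to X]/(\sum_(i <- s) y i).
rewrite !linear_sum; apply: eq_bigr => i _; rewrite {}/y.
set g : S := lin_comp (dsum_proj M i) f.
have -> : homtens_dsum_to (pure (lin_comp (dsum_inj M i) g) (1 : qring K)) =
    dsum_inj SK i (qproj K g).
  rewrite /= tens_lift_pure; last exact: homtens_coord_balanced.
  apply: dsumE => j; rewrite /= /homtens_coord_fun mulr1.
  have [->|/eqP/nesym ij] := eqVneq (i : {classic I}) j.
    by rewrite dsum_injE; congr (qproj K _); apply: linear_eq => x; apply: dsum_injE.
  rewrite dsum_injNE // -[RHS](raddf0 (qproj K)).
  by congr (qproj K _); apply: linear_eq => x; apply: dsum_injNE.
by rewrite /homtens_dsum_of dsum_lift_inj /= pure_qproj.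
Qed.
End DirectSum.
End HomTensorAdd.

Section HomTensorFunctor.
Variables (R : pzRingType) (M : rmodType R) (K : bideal (endring M)).
Hypothesis M_fg : fin_generated M.
Local Notation SK := (rregular (qring K)).
Local Notation F := (homtens K).

Lemma homtens_retract (B N : rmodType R) : retract B N -> retract (F B) (F N).
Proof.
move=> [s [r rs]]; exists (homtens_map K s), (homtens_map K r).
apply: (lin_congr (f := lin_comp _ _) (g := lin_id _)).
rewrite -homtens_mapM -homtens_map1; congr homtens_map; exact/linear_eq.
Qed.

Lemma homtens_dsum_retract (I : Type) : retract (F (dsum I M)) (dsum I SK).
Proof. by exists (homtens_dsum_to K M_fg I), (homtens_dsum_of K I); apply: homtens_dsum_toK. Qed.

Lemma dsum_homtens_retract (I : Type) : retract (dsum I SK) (F (dsum I M)).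
Proof. by exists (homtens_dsum_of K I), (homtens_dsum_to K M_fg I); apply: homtens_dsum_ofK. Qed.

Lemma homtens_Add (B : rmodType R) : in_Add M B -> in_Add SK (F B).
Proof.
move=> /in_AddP[I rB]; apply/in_AddP; exists I.
exact: retract_trans (homtens_retract rB) (homtens_dsum_retract I).
Qed.

Lemma regular_count_generated (T : pzRingType) : count_generated (rregular T).
Proof.
apply/count_generatedP; exists (fun=> 1) => Q [_ _ QZ] Q1 x.
have -> : x = (x : T^c) *: (1 : rregular T) := esym (@mul1r T x).
exact: QZ (Q1 0%N).
Qed.

Lemma homtens_Add0 (B : rmodType R) : in_Add0 M B -> in_Add0 SK (F B).
Proof.
move=> [AB cB]; split; first exact: homtens_Add.
have [I rB] := (in_AddP M B).1 AB.
have rB' := retract_dsum_nat cB rB.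
apply: retract_count_generated (count_generated_dsum (@regular_count_generated (qring K))).
exact: retract_trans (homtens_retract rB') (homtens_dsum_retract nat).
Qed.

Lemma homtens_dsum_ext (I : Type) (W : rmodType (qring K)) (f g : {linear F (dsum I M) -> W}) :
  (forall i, f (pure (dsum_inj M i) (1 : qring K)) = g (pure (dsum_inj M i) (1 : qring K))) ->
  f = g.
Proof.
move=> fg; apply/linear_eq => y; rewrite -[y](homtens_dsum_toK (K := K) M_fg).
move: (homtens_dsum_to K M_fg I y) => {y}z.
apply: (lin_congr (f := lin_comp f _) (g := lin_comp g _)) z.
apply: dsum_ext => i c; rewrite /= /homtens_dsum_of dsum_lift_inj /= pure_linE.
by rewrite !linearZ fg.
Qed.

(** On a direct sum of copies of [M], each value of [g] on [pure (inj i) 1] has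
the form [pure b_i 1]; the maps [b_i] assemble to the required map. *)
Lemma homtens_full (A B : rmodType R) (g : {linear F A -> F B}) :
  in_Add M A -> exists f : {linear A -> B}, homtens_map K f = g.
Proof.
move=> /in_AddP[I [s [r rs]]].
pose g' := lin_comp g (homtens_map K r).
have bP i := cid (tens_quo_pure1 (g' (pure (dsum_inj M i) (1 : qring K)))).
pose f' := dsum_lift (fun i => sval (bP i)).
have f'E : homtens_map K f' = g'.
  apply: homtens_dsum_ext => i; rewrite (svalP (bP i)) [LHS]homtens_map_pure.
  by congr pure; apply/linear_eq => x; rewrite /= /f' dsum_lift_inj.
exists (lin_comp f' s); rewrite homtens_mapM f'E /g'.
apply/linear_eq => y /=; congr (g _).
apply: (lin_congr (f := lin_comp (homtens_map K r) (homtens_map K s)) (g := lin_id _)).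
rewrite -homtens_mapM -homtens_map1; congr homtens_map; exact/linear_eq.
Qed.
End HomTensorFunctor.

Section KernelOfFunctor.
Variables (R : pzRingType) (M X : rmodType R).
Hypotheses (M_fg : fin_generated M) (X_Add : in_Add M X).
Local Notation P := ({linear M -> X} : rmodType (endring M)).
Local Notation K := (trace_ideal P).

Lemma pure1_factJ (B : rmodType R) (f : {linear M -> B}) :
  pure f (1 : qring K) = 0 <-> factJ X M B f.
Proof.
apply: iff_trans (pure1_eq0 _ _) _; rewrite -trace_set.
exact: mod_ideal_factJ.
Qed.

(** Precomposing with a map from [M] gives an element of J(M,B), on which
[pure _ 1] vanishes. *)
Lemma homtens_factJ (A B : rmodType R) (f : {linear A -> B}) :
  factJ X A B f -> homtens_map K f = 0.
Proof.
move=> [I [g [h fE]]]; apply/linear_eq/homtens_ext => a.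
rewrite [LHS]homtens_map_pure; apply/pure1_factJ.
by exists I, (lin_comp g a), h => x; rewrite /= fE.
Qed.

(** Reduced to [A] a direct sum of copies of [M], the components of [f] each
factor through some direct sum of copies of [X], so [f] factors through the
direct sum of these, indexed by the dependent sum of the index types. *)
Lemma homtens_faithful (A B : rmodType R) (f : {linear A -> B}) :
  in_Add M A -> homtens_map K f = 0 -> factJ X A B f.
Proof.
move=> /in_AddP[I [s [r rs]]] f0.
have fiJ i : factJ X M B (lin_comp f (lin_comp r (dsum_inj M i))).
  by apply/pure1_factJ; rewrite -homtens_map_pure f0.
pose L i := projT1 (cid (fiJ i)).
have hP i : exists gh : {linear M -> dsum (L i) X} * {linear dsum (L i) X -> B},
    lin_comp f (lin_comp r (dsum_inj M i)) = lin_comp gh.2 gh.1.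
  rewrite /L; case: cid => J /= [g [h gh]]; exists (g, h); exact/linear_eq.
pose g i := (sval (cid (hP i))).1; pose h i := (sval (cid (hP i))).2.
have ghE i : lin_comp f (lin_comp r (dsum_inj M i)) = lin_comp (h i) (g i).
  exact: svalP (cid (hP i)).
exists {i & L i}.
pose inc i := dsum_lift (fun l => dsum_inj X (existT L i l)).
pose out := dsum_lift (fun il : {i & L i} => lin_comp (h (projT1 il)) (dsum_inj X (projT2 il))).
exists (lin_comp (dsum_lift (fun i => lin_comp (inc i) (g i))) s), out.
suff frE : lin_comp f r = lin_comp out (dsum_lift (fun i => lin_comp (inc i) (g i))).
  by move=> x; rewrite -[x in LHS]rs; apply: (lin_congr frE).
apply: dsum_ext => i a; rewrite [LHS](lin_congr (ghE i)) /= dsum_lift_inj /=.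
apply: (lin_congr (f := h i) (g := lin_comp out (inc i))).
by apply: dsum_ext => l x; rewrite /= /inc /out !dsum_lift_inj.
Qed.
End KernelOfFunctor.

(** * Splitting idempotents modulo a factor ideal *)

Section PairLinear.
Variables (R : pzRingType) (A B C : lmodType R).

Fact pair_is_linear (f : {linear A -> B}) (g : {linear A -> C}) :
  linear (fun x => (f x, g x)).
Proof. by move=> a x y; rewrite !linearP. Qed.
Definition pair_lin f g : {linear A -> (B * C)%type} := mklin (pair_is_linear f g).

Fact copair_is_linear (f : {linear A -> C}) (g : {linear B -> C}) :
  linear (fun z : A * B => f z.1 + g z.2).
Proof. by move=> a x y; rewrite /= !linearP scalerDr addrACA. Qed.
Definition copair_lin f g : {linear (A * B)%type -> C} := mklin (copair_is_linear f g).
End PairLinear.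

(** Here [dsum nat A] is thought of as A[t], with [dsum_inj A n a] in the role of
[a t^n]. The module [split_obj] is the telescope of [f], realized not as a
cokernel but as the kernel of a retraction of the relation map [tele]. *)
Section IdempotentSplitting.
Variables (R : pzRingType) (A Y : lmodType R).
Variables (f : {linear A -> A}) (g : {linear A -> Y}) (h : {linear Y -> A}).
Hypothesis fE : forall a, f a - f (f a) = h (g a).

Local Notation At := (dsum nat A).
Local Notation Yt := (dsum nat Y).
Local Notation ft := (dsum_map nat f).
Local Notation gt := (dsum_map nat g).
Local Notation ht := (dsum_map nat h).

Definition shift : {linear At -> At} := dsum_lift (fun n => dsum_inj A n.+1).
(** [t^n |-> t + t^2 + ... + t^(n+1)], that is, [t] times the sum of all powers
of the truncated backward shift. *)
Definition geom : {linear At -> At} :=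
  dsum_lift (fun n => \sum_(i < n.+1) dsum_inj A i.+1).
(** Evaluation at [t = 1]. *)
Definition total : {linear At -> A} := dsum_lift (fun=> lin_id A).

Lemma shift_inj n a : shift (dsum_inj A n a) = dsum_inj A n.+1 a.
Proof. exact: dsum_lift_inj. Qed.

Lemma geom_inj n a : geom (dsum_inj A n a) = \sum_(i < n.+1) dsum_inj A i.+1 a.
Proof. by rewrite /geom dsum_lift_inj lin_sumE. Qed.

Lemma total_inj n a : total (dsum_inj A n a) = a.
Proof. by rewrite /total dsum_lift_inj. Qed.

Lemma geom_shift x : geom (shift x) = geom x + shift (shift x).
Proof.
apply: (lin_congr (f := lin_comp geom shift) (g := geom + lin_comp shift shift)) x.
apply: dsum_ext => n a; rewrite lin_addE /= !shift_inj !geom_inj.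
by rewrite big_ord_recr.
Qed.

Lemma map_shift x : ft (shift x) = shift (ft x).
Proof.
apply: (lin_congr (f := lin_comp ft shift) (g := lin_comp shift ft)) x.
by apply: dsum_ext => n a; rewrite /= !(shift_inj, dsum_map_inj).
Qed.

Lemma map_idem x : ft x - ft (ft x) = ht (gt x).
Proof.
apply: (lin_congr (f := ft - lin_comp ft ft) (g := lin_comp ht gt)) x.
by apply: dsum_ext => n a; rewrite lin_subE /= !dsum_map_inj -raddfB fE.
Qed.

(** Multiplied by [t], a polynomial and its value at 1 differ by a multiple of
[1 - t]: for [t^n] this reads [t = t^(n+1) + (1 - t)(t + ... + t^n)]. *)
Lemma shift_total x :
  shift (dsum_inj A 0%N (total x)) =
  shift x + ((geom x - shift x) - shift (geom x - shift x)).
Proof.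
pose d := geom - shift.
apply: (lin_congr (f := lin_comp shift (lin_comp (dsum_inj A 0%N) total))
  (g := shift + (d - lin_comp shift d))) x.
apply: dsum_ext => n a; rewrite /d !(lin_addE, lin_oppE) /=.
rewrite !(total_inj, shift_inj, geom_inj).
rewrite big_ord_recr /= addrK linear_sum addrA.
transitivity (\sum_(i < n.+1) dsum_inj A i.+1 a - \sum_(i < n) dsum_inj A i.+2 a).
  by rewrite big_ord_recl /= addrK.
rewrite big_ord_recr /= [X in _ = X - _]addrC; congr (_ - _).
by apply: eq_bigr => i _; rewrite shift_inj.
Qed.

Definition tele : {linear At -> (At * Yt)%type} :=
  pair_lin (lin_id At - lin_comp shift ft) (- gt).
(** With [D] the truncated backward shift and [G = geom = t (1 + D + D^2 + ...)],
one needs [p (1 - t f) + G h g = 1], that is, [1 - G (f - f^2)] must be a left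
multiple of [1 - t f].  Modulo the left ideal generated by [1 - t f] one has
[f = D] and [t D = 1], and [G (D - D^2) = t D]; this suggests [G], and division
gives the cofactor [p = 1 - (G - t) f]. *)
Definition tele_retr : {linear (At * Yt)%type -> At} :=
  copair_lin (lin_id At - lin_comp (geom - shift) ft) (- lin_comp geom ht).

Lemma tele_retrK x : tele_retr (tele x) = x.
Proof.
set t := shift (ft x); set b := geom (ft x) - geom (ft (ft x)).
have bE : geom (ht (- gt x)) = - b by rewrite !raddfN /= -map_idem raddfB.
have E : geom (ft (x - t)) - shift (ft (x - t)) = b - t.
  rewrite !linearB /= map_shift geom_shift.
  by rewrite opprK opprD !addrA [LHS]addrAC subrK.
transitivity (x - t - (geom (ft (x - t)) - shift (ft (x - t))) - geom (ht (- gt x))).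
  by [].
rewrite E bE opprK opprB; clearbody b t.
by rewrite addrA !subrK.
Qed.

Definition split_obj := kernel tele_retr.

Fact split_proj_subproof z : tele_retr (z - tele (tele_retr z)) = 0.
Proof. by rewrite linearB tele_retrK subrr. Qed.
Definition split_proj : {linear (At * Yt)%type -> split_obj} :=
  ker_lift (g := lin_id _ - lin_comp tele tele_retr) split_proj_subproof.

Lemma split_projK (b : split_obj) : split_proj (ker_incl tele_retr b) = b.
Proof.
apply: val_inj; rewrite -[LHS]/(ker_val b - tele (tele_retr (ker_val b))).
by rewrite ker_valP linear0 subr0.
Qed.

Lemma split_proj_tele x : split_proj (tele x) = 0.
Proof.
apply: val_inj; rewrite -[LHS]/(tele x - tele (tele_retr (tele x))).
by rewrite tele_retrK subrr.
Qed.

Lemma split_retract : retract split_obj (At * Yt)%type.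
Proof. by exists (ker_incl tele_retr), split_proj; apply: split_projK. Qed.

(* [e1] and [e2] are the two components of the projection onto the telescope;
   [v0] is the cocone (f, h) on A[t] + Y[t], evaluated at [t = 1]. *)
Let e1 : {linear At -> split_obj} := lin_comp split_proj (pair_lin (lin_id At) 0).
Let e2 : {linear Yt -> split_obj} := lin_comp split_proj (pair_lin 0 (lin_id Yt)).
Let v0 : {linear (At * Yt)%type -> A} :=
  copair_lin (lin_comp f total) (lin_comp h (dsum_lift (fun=> lin_id Y))).

Definition split_to : {linear A -> split_obj} := lin_comp e1 (dsum_inj A 0%N).
Definition split_from : {linear split_obj -> A} := lin_comp v0 (ker_incl tele_retr).

Let e12 x y : split_proj (x, y) = e1 x + e2 y.
Proof.
rewrite -[RHS]/(split_proj (x, 0) + split_proj (0, y)) -linearD.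
by congr (split_proj _); congr (_, _); rewrite /= ?addr0 ?add0r.
Qed.

Let e1_rel x : e1 x = e1 (shift (ft x)) + e2 (gt x).
Proof.
have : split_proj (x - shift (ft x), - gt x) = 0 := split_proj_tele x.
rewrite e12 [e1 _]linearB [e2 _]linearN => /eqP.
by rewrite subr_eq0 subr_eq => /eqP ->; rewrite addrC.
Qed.

Lemma split_fromK a : split_from (split_to a) = f a.
Proof.
have v0_tele x : v0 (tele x) = 0.
  apply: (lin_congr (f := lin_comp v0 tele) (g := 0)) x; apply: dsum_ext => n a'.
  rewrite -[LHS]/(f (total (dsum_inj A n a' - shift (ft (dsum_inj A n a')))) +
    h (dsum_lift (fun=> lin_id Y) (- gt (dsum_inj A n a')))).
  rewrite !linearB !linearN /= !dsum_map_inj shift_inj !total_inj dsum_lift_inj /=.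
  by rewrite fE subrr.
rewrite -[LHS]/(v0 ((dsum_inj A 0%N a, 0) - tele (tele_retr (dsum_inj A 0%N a, 0)))).
rewrite linearB v0_tele subr0 /= total_inj /=.
by rewrite [dsum_lift _ 0]linear0 linear0 addr0.
Qed.

(** From here on the computation takes place in the quotient of the category of
modules by the maps factoring through sums of copies of [X]. The hypothesis
says that [Y[t]] is zero there. *)
Section Quotient.
Variables (X : lmodType R) (YJ : forall (B : lmodType R) (k : {linear Yt -> B}), factJ X Yt B k).

Local Notation J := (idealJ X).
Let cls (U V : lmodType R) (k : {linear U -> V}) : @hom (quot_cat J) U V :=
  qmor J (k : @hom (Mod R) U V).

Let clsM (U V W : lmodType R) (k : {linear V -> W}) (l : {linear U -> V}) :
  cls (lin_comp k l) = cls k \oc cls l.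
Proof. exact: (@qmorM (Mod R) J). Qed.

Let cls_factor (U V : lmodType R) (k l : {linear U -> V}) (p : {linear Yt -> V})
    (q : {linear U -> Yt}) :
  (forall x, k x - l x = p (q x)) -> cls k = cls l.
Proof.
move=> klE; apply/(@qmor_eq (Mod R) J).
have -> : k - l = lin_comp p q by apply/linear_eq.
by apply: (@factJMr R X U Yt V); apply/factJP/YJ.
Qed.

Let fstL : {linear (At * Yt)%type -> At} := copair_lin (lin_id At) 0.
Let sndL : {linear (At * Yt)%type -> Yt} := copair_lin 0 (lin_id Yt).

Let e1_shift_map : cls e1 \oc (cls shift \oc cls ft) = cls e1.
Proof.
rewrite -!clsM; apply/esym/(@cls_factor _ _ _ _ e2 gt) => x.
by rewrite [e1 x]e1_rel addrAC subrr add0r.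
Qed.

Let map_idem_mod : cls ft \oc cls ft = cls ft.
Proof.
rewrite -clsM; apply/esym/(@cls_factor _ _ _ _ ht gt) => x; exact: map_idem.
Qed.

(* From [e1 = e1 t f] and [f^2 = f] modulo the ideal: [e1 f = e1], then
   [e1 t = e1 f t = e1 t f = e1]. So [f] and [t] act trivially on [e1]. *)
Let e1_map : cls e1 \oc cls ft = cls e1.
Proof. by rewrite -{1}e1_shift_map -!compA map_idem_mod. Qed.

Let e1_shift : cls e1 \oc cls shift = cls e1.
Proof.
rewrite -{1}e1_map -compA -clsM.
have -> : lin_comp ft shift = lin_comp shift ft by apply/linear_eq/map_shift.
by rewrite clsM.
Qed.

(* The multiple of [1 - t] in [shift_total] is annihilated by [e1]. *)
Let e1_total : cls e1 \oc (cls (dsum_inj A 0%N) \oc cls total) = cls e1.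
Proof.
rewrite -{1}e1_shift -compA -(clsM (dsum_inj A 0%N)) -(clsM shift).
pose d := geom - shift.
have -> : lin_comp shift (lin_comp (dsum_inj A 0%N) total) = shift - (lin_comp shift d - d).
  by apply/linear_eq => x; rewrite /= shift_total opprB.
clearbody d; have clsB (U V : lmodType R) (k l : {linear U -> V}) : cls (k - l) = cls k - cls l.
  exact: (@qmorB (Mod R) J).
by rewrite !clsB clsM !Defs.compBr compA e1_shift subrr subr0.
Qed.

Lemma split_to_from : factJ X _ _ (lin_comp split_to split_from - lin_id split_obj).
Proof.
apply/factJP/(@qmor_eq (Mod R) J).
rewrite -[LHS]/(cls (lin_comp (lin_comp e1 (dsum_inj A 0%N)) (lin_comp v0 (ker_incl tele_retr)))).
have v0E : cls v0 = cls (lin_comp f (lin_comp total fstL)).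
  apply: (@cls_factor _ _ _ _ (lin_comp h (dsum_lift (fun=> lin_id Y))) sndL) => z.
  by rewrite /= addr0 add0r addrAC subrr add0r.
have projE : cls split_proj = cls (lin_comp e1 fstL).
  apply: (@cls_factor _ _ _ _ e2 sndL) => -[x y].
  rewrite e12 -[lin_comp e1 fstL _]/(e1 (x + 0)) -[sndL _]/(0 + y).
  by rewrite addr0 add0r addrAC subrr add0r.
have inj0E : cls (dsum_inj A 0%N) \oc cls f = cls ft \oc cls (dsum_inj A 0%N).
  by rewrite -!clsM; congr cls; apply/linear_eq => a; rewrite /= dsum_map_inj.
have <- : lin_comp split_proj (ker_incl tele_retr) = lin_id split_obj.
  exact/linear_eq/split_projK.
rewrite -[RHS]/(cls (lin_comp split_proj (ker_incl tele_retr))).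
rewrite (clsM split_proj) (clsM (lin_comp e1 _)) (clsM e1) (clsM v0) v0E projE.
rewrite (clsM f) (clsM total) (clsM e1) !compA.
by rewrite -(compA (cls e1)) inj0E compA e1_map -(compA (cls e1)) e1_total.
Qed.

End Quotient.
End IdempotentSplitting.

(** * The essential image, and the equivalences *)

Lemma idempotent_splits (R : pzRingType) (X A : lmodType R) (L : Type)
  (f : {linear A -> A}) (g : {linear A -> dsum L X}) (h : {linear dsum L X -> A}) :
  (forall a, f a - f (f a) = h (g a)) ->
  exists (B : lmodType R) (u : {linear A -> B}) (v : {linear B -> A}),
    [/\ retract B (dsum nat A * dsum nat (dsum L X))%type, lin_comp v u = f
      & factJ X B B (lin_comp u v - lin_id B)].
Proof.
move=> fE; exists (split_obj f h), (split_to fE), (split_from f h); split.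
- exact: split_retract.
- exact/linear_eq/split_fromK.
apply: split_to_from => // B k.
exists (nat * L)%type, (dsum_flatten nat L X), (lin_comp k (dsum_nest nat L X)) => x.
by rewrite /= -[RHS]/(k (lin_comp _ _ x)) dsum_flattenK.
Qed.

Section EssentialImage.
Variables (R : pzRingType) (M X : rmodType R).
Hypotheses (M_fg : fin_generated M) (X_Add : in_Add M X).
Local Notation P := ({linear M -> X} : rmodType (endring M)).
Local Notation K := (trace_ideal P).
Local Notation SK := (rregular (qring K)).
Local Notation F := (homtens K).

Definition lin_iso (T : pzRingType) (U V : lmodType T) :=
  exists (u : {linear U -> V}) (v : {linear V -> U}),
    lin_comp v u = lin_id U /\ lin_comp u v = lin_id V.

(** The idempotent [s r] of F(A) comes from some [f] by fullness, and [f] is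
idempotent modulo the ideal by faithfulness. The factorization of [f - f^2] is
left open in the second part, so that a countable one can be supplied when the
given module is countably generated. *)
Lemma homtens_lift (I : Type) (Y : rmodType (qring K)) : retract Y (dsum I SK) ->
  exists f : {linear dsum I M -> dsum I M},
    factJ X _ _ (f - lin_comp f f) /\
    forall (L : Type) (g : {linear dsum I M -> dsum L X})
        (h : {linear dsum L X -> dsum I M}),
      (forall a, f a - f (f a) = h (g a)) ->
      exists B : rmodType R,
        retract B (dsum nat (dsum I M) * dsum nat (dsum L X))%type /\ lin_iso (F B) Y.
Proof.
move=> rY; have [s [r rs]] := retract_trans rY (dsum_homtens_retract K M_fg I).
have A_Add : in_Add M (dsum I M) by exact/in_Add_dsum/in_Add_self.
have [f fE] := homtens_full M_fg (lin_comp s r) A_Add.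
exists f; split=> [|L g h fgh].
  apply: (homtens_faithful M_fg X_Add A_Add).
  rewrite homtens_mapB homtens_mapM fE; apply/linear_eq => y.
  by rewrite lin_subE /= rs subrr.
have [B [u [v [rB vu uv]]]] := idempotent_splits fgh.
exists B; split=> //.
have Fuv : lin_comp (homtens_map K u) (homtens_map K v) = lin_id (F B).
  apply/eqP; rewrite -subr_eq0 -homtens_mapM -homtens_map1 -homtens_mapB.
  exact/eqP/homtens_factJ.
have Fvu : lin_comp (homtens_map K v) (homtens_map K u) = lin_comp s r.
  by rewrite -homtens_mapM vu.
exists (lin_comp r (homtens_map K v)), (lin_comp (homtens_map K u) s).
have FuvE z : homtens_map K u (homtens_map K v z) = z := lin_congr Fuv z.
have FvuE z : homtens_map K v (homtens_map K u z) = s (r z) := lin_congr Fvu z.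
split; apply/linear_eq => y.
  rewrite -[LHS]/(homtens_map K u (s (r (homtens_map K v y)))).
  by rewrite -FvuE !FuvE.
rewrite -[LHS]/(r (homtens_map K v (homtens_map K u (s y)))).
by rewrite FvuE !rs.
Qed.

Lemma homtens_ess (Y : rmodType (qring K)) : in_Add SK Y ->
  exists B : rmodType R, in_Add M B /\ lin_iso (F B) Y.
Proof.
move=> /in_AddP[I /homtens_lift[f [[L [g [h fgh]]] /(_ L g h fgh) [B [rB FB]]]]].
exists B; split=> //; apply: retract_in_Add rB _.
have A_Add : in_Add M (dsum I M) by exact/in_Add_dsum/in_Add_self.
apply: in_Add_prod; first exact: in_Add_dsum.
exact/in_Add_dsum/in_Add_dsum.
Qed.

Lemma homtens_ess0 (Y : rmodType (qring K)) : count_generated X -> in_Add0 SK Y ->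
  exists B : rmodType R, in_Add0 M B /\ lin_iso (F B) Y.
Proof.
move=> cX [/in_AddP[I rY] cY].
(* [g] lands in countably many copies of [X], as its source is countably
   generated; restricting to these keeps [B] countably generated. *)
have [f [[L [g [h fgh]]] lift]] := homtens_lift (retract_dsum_nat cY rY).
have cM := fg_count_generated M_fg.
have cA := count_generated_dsum cM.
have [p [j jp]] := count_generated_factor g cA.
have [|B [rB FB]] := lift nat (lin_comp p g) (lin_comp h j).
  by move=> a; rewrite /= jp; apply: fgh.
have A_Add : in_Add M (dsum nat M) by exact/in_Add_dsum/in_Add_self.
exists B; split=> //; split.
  apply: retract_in_Add rB _; apply: in_Add_prod; first exact: in_Add_dsum.
  exact/in_Add_dsum/in_Add_dsum.
apply: retract_count_generated rB _; apply: count_generated_prod.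
  exact: count_generated_dsum.
exact/count_generated_dsum/count_generated_dsum.
Qed.
End EssentialImage.

Theorem theorem2p11 (R : pzRingType) (M X : rmodType R)
    (M_fg : fin_generated M) (X_Add : in_Add M X) :
  let S : pzRingType := endring M in
  let P : rmodType S := {linear M -> X} in
  let I := trace P in
  let SI : pzRingType := qring (trace_ideal P) in
  let F : functor (Mod R^c) (Mod SI^c) := homtens_functor (trace_ideal P) in
  let J := idealJ X in
  [/\ (* (i) *)
      [/\ I = factI X M M,
          factI X M M = factJ X M M
        & forall B : rmodType R, in_Add M B ->
            factI X M B = factJ X M B /\
            factJ X M B = mod_ideal (N := {linear M -> B}) I],
      (* (ii) *)
      exists (F_Add : forall B, in_Add M B -> in_Add (rregular SI) (F B))
             (F_J : kills (ideal_restrict J (in_Add M))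
                      (full_restrict F (in_Add M) (in_Add (rregular SI)) F_Add)),
        is_equivalence
          (induced F_J : functor (Add_quot M X) (Add_cat (rregular SI)))
    & (* (iii) *)
      in_Add0 M X ->
      exists (F_Add0 : forall B, in_Add0 M B -> in_Add0 (rregular SI) (F B))
             (F_J : kills (ideal_restrict J (in_Add0 M))
                      (full_restrict F (in_Add0 M) (in_Add0 (rregular SI)) F_Add0)),
        is_equivalence
          (induced F_J : functor (Add0_quot M X) (Add0_cat (rregular SI)))].
Proof.
move=> S P I SI F J.
have IJ (B : rmodType R) : factI X M B = factJ X M B.
  by apply/seteqP; split=> f; [apply: factI_factJ | apply: factJ_factI].
split.
- split=> [||B _]; [|exact: IJ|split; first exact: IJ].
    rewrite IJ; apply/seteqP; split=> s.
      exact: (trace_factJ M_fg X_Add s).1.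
    exact: (trace_factJ M_fg X_Add s).2.
  apply/seteqP; split=> f; first exact: (mod_ideal_factJ M_fg X_Add f).2.
  exact: (mod_ideal_factJ M_fg X_Add f).1.
- exists (@homtens_Add _ _ _ M_fg).
  have FJ : kills (ideal_restrict J (in_Add M)) (full_restrict F (in_Add M)
      (in_Add (rregular SI)) (@homtens_Add _ _ (trace_ideal P) M_fg)).
    by move=> A B f /factJP; apply: homtens_factJ.
  exists FJ; apply: induced_equivalence.
  + move=> [A A_Add] B f f0; apply/factJP; exact: (homtens_faithful M_fg X_Add A_Add f0).
  + move=> [A A_Add] B g; exact: (homtens_full M_fg g A_Add).
  + move=> [Y Y_Add]; have [B [B_Add [u [v uv]]]] := homtens_ess M_fg X_Add Y_Add.
    by exists (exist _ B B_Add), u, v.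
move=> [_ cX]; exists (@homtens_Add0 _ _ _ M_fg).
have FJ : kills (ideal_restrict J (in_Add0 M)) (full_restrict F (in_Add0 M)
    (in_Add0 (rregular SI)) (@homtens_Add0 _ _ (trace_ideal P) M_fg)).
  by move=> A B f /factJP; apply: homtens_factJ.
exists FJ; apply: induced_equivalence.
+ move=> [A [A_Add cA]] B f f0; apply/factJP; exact: (homtens_faithful M_fg X_Add A_Add f0).
+ move=> [A [A_Add cA]] B g; exact: (homtens_full M_fg g A_Add).
+ move=> [Y Y_Add]; have [B [B_Add [u [v uv]]]] := homtens_ess0 M_fg X_Add cX Y_Add.
  by exists (exist _ B B_Add), u, v.
Qed.
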